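(* Let $(M,g)$ be the Hayward black hole spacetime with parameters $m$ (mass) and $b$ (length-scale): in spherical coordinates $(x^1,x^2,x^3,x^4)=(t,r,\theta,\phi)$, $g=-\frac{B}{B_1}dt^2+\frac{B_1}{B}dr^2+r^2(d\theta^2+\sin^2\theta\, d\phi^2)$, where $B=2b^2m+r^2(r-2m)$ and $B_1=2b^2m+r^3$ (so that $\frac{B}{B_1}=1-\frac{2mr^2}{r^3+2mb^2}$). Put $B_2=4b^2m-r^3$, $B_3=b^2m-r^3$. Let $R,S,\kappa,C,P,W,K$ be the Riemann, Ricci, scalar, conformal, projective, concircular and conharmonic curvatures (conventions in the context). Then the spacetime admits the following curvature properties. (i) $R\cdot R=-\frac{mB_2}{B_1^2}Q(g,R)$. Hence $R\cdot H=-\frac{mB_2}{B_1^2}Q(g,H)$ for each $H\in\{S,C,P,W,K\}$. (ii) $C\cdot R=-\frac{mr^3B_2}{B_1^3}Q(g,R)$. Hence $C\cdot H=-\frac{mr^3B_2}{B_1^3}Q(g,H)$ for each $H\in\{S,C,P,W,K\}$. (iii) $W\cdot R=-\frac{mr^3B_2}{B_1^3}Q(g,R)$. Hence $W\cdot H=-\frac{mr^3B_2}{B_1^3}Q(g,H)$ for each $H\in\{S,C,P,W,K\}$. (iv) $K\cdot R=\frac{mB_2^2}{B_1^3}Q(g,R)$. Hence $K\cdot H=\frac{mB_2^2}{B_1^3}Q(g,H)$ for each $H\in\{S,C,P,W,K\}$. (v) $R\cdot R-\mathcal L\,Q(g,C)=Q(S,R)$, where $\mathcal L=\frac{m(16b^2m-r^3)}{B_2B_1}$.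 (vi) The tensor $C\cdot R-R\cdot C$ depends linearly on the tensors $Q(g,C)$, $Q(S,C)$, $Q(g,R)$ and $Q(S,R)$. (vii) It is Ricci pseudosymmetric due to projective curvature: $P\cdot S=-\frac{mB_2}{B_1^2}Q(g,S)$. (viii) Its conformal curvature $2$-forms are recurrent for the $1$-form with components $\left\{0,\ -\frac{6b^2m(8b^2m-5r^3)}{8b^4m^2r+2b^2mr^4-r^7},\ 0,\ 0\right\}$. (ix) It is a Roter type spacetime: $R=\varsigma_1\, g\wedge g+\varsigma_2\, g\wedge S+\varsigma_3\, S\wedge S$ for some scalars $\varsigma_1,\varsigma_2,\varsigma_3$. (x) It is an Einstein manifold of level $2$: $S^2+\psi_1S+\psi_2g=0$ with $\psi_1=\frac{12b^2m^2B_2}{B_1^3}$ and $\psi_2=\frac{288b^4m^4B_3}{B_1^5}$. (xi) It is $2$-quasi-Einstein, i.e. $S-\alpha g$ has rank $2$, for $\alpha=-\frac{12b^2m^2}{B_1^2}$. (xii) It is generalized quasi-Einstein in the sense of Chaki, i.e. $S=\alpha g+\beta\,\Pi\otimes\Pi+\gamma(\Pi\otimes\Phi+\Phi\otimes\Pi)$, with $\alpha=-\frac{12b^2m^2}{B_1^2}$, $\beta=1$, $\gamma=1$, and $1$-forms with components $\Pi=\left\{-\frac{B}{B_1},1,0,0\right\}$ and $\Phi=\left\{\frac{36b^2m^2r^3+B_1^2B}{2B_1^3},\ \frac{18b^2m^2r^3}{B_1^2B}-\frac12,\ 0,\ 0\right\}$. (xiii) For each $T\in\{R,C,P,W,K\}$,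 the general form of a $T$-compatible $(0,2)$-tensor, in the coordinates $(t,r,\theta,\phi)$, is $$\begin{pmatrix} Z_{11}&Z_{12}&0&0\\ Z_{12}&Z_{22}&0&0\\ 0&0&Z_{33}&Z_{34}\\ 0&0&Z_{34}&Z_{44}\end{pmatrix}$$ where the $Z_{ij}$ are arbitrary scalars. (xiv) The Ricci tensor $S$ is $T$-compatible for each $T\in\{C,P,R,K,W\}$.
   Context: Conventions ($n=\dim M=4$, $\nabla$ the Levi-Civita connection). Components of $1$-forms are with respect to $(dt,dr,d\theta,d\phi)$. Curvature: $R$ is the $(0,4)$ Riemann curvature tensor, the Ricci tensor is $S_{q\mu}=g^{p\nu}R_{pq\mu\nu}$ and $\kappa=g^{q\mu}S_{q\mu}$; the overall sign of $R$ is fixed by the following component values for the present metric: $R_{3434}=\frac{2mr^4\sin^2\theta}{B_1}$, $S_{33}=-\frac{12b^2m^2r^2}{B_1^2}$, $\kappa=\frac{24b^2m^2(r^3-4b^2m)}{B_1^3}$. $S^2(X,Y)=S(\mathcal JX,Y)$, where $g(\mathcal JX,Y)=S(X,Y)$. Kulkarni–Nomizu product of symmetric $(0,2)$-tensors: $(A\wedge U)_{pq\mu\nu}=A_{p\nu}U_{q\mu}-A_{p\mu}U_{q\nu}+A_{q\mu}U_{p\nu}-A_{q\nu}U_{p\mu}$. Curvature tensors of type $(0,4)$: conformal $C=R-\frac1{n-2}g\wedge S+\frac{\kappa}{2(n-1)(n-2)}g\wedge g$; concircular $W=R-\frac{\kappa}{2n(n-1)}g\wedge g$; conharmonic $K=R-\frac{1}{n-2}g\wedge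 S$; projective $P_{pq\mu\nu}=R_{pq\mu\nu}-\frac1{n-1}(g_{p\nu}S_{q\mu}-g_{q\nu}S_{p\mu})$. For a $(0,4)$-tensor $T$ and a $(0,k)$-tensor $H$: $(T\cdot H)_{q_1\cdots q_k\nu\mu}=-g^{pr}[T_{\mu\nu q_1r}H_{pq_2\cdots q_k}+\cdots+T_{\mu\nu q_kr}H_{q_1\cdots q_{k-1}p}]$. For a symmetric $(0,2)$-tensor $Z$ the Tachibana tensor is $Q(Z,H)_{q_1\cdots q_k\nu\mu}=Z_{\mu q_1}H_{\nu q_2\cdots q_k}+\cdots+Z_{\mu q_k}H_{q_1\cdots q_{k-1}\nu}-Z_{\nu q_1}H_{\mu q_2\cdots q_k}-\cdots-Z_{\nu q_k}H_{q_1\cdots q_{k-1}\mu}$. The conformal curvature $2$-forms are recurrent for a $1$-form $\Sigma$ if $\mathcal S_{X_1,X_2,X_3}(\nabla_{X_1}C)(X_2,X_3,X_4,X_5)=\mathcal S_{X_1,X_2,X_3}\Sigma(X_1)C(X_2,X_3,X_4,X_5)$ for all vector fields, $\mathcal S$ denoting the cyclic sum over $X_1,X_2,X_3$. A $(0,2)$-tensor $Z$, with corresponding endomorphism $\mathcal Z$ given by $g(\mathcal ZX,Y)=Z(X,Y)$, is $T$-compatible (for a $(0,4)$-tensor $T$) if $\mathcal S_{X_1,X_2,X_3}T(\mathcal ZX_1,X,X_2,X_3)=0$ for all vector fields $X,X_1,X_2,X_3$.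
   Formalization: In (viii) the 1-form has the opposite sign, since the printed sign fails; in (xiii) and (xiv) for T=P, compatibility means the cyclic sum of P(X2,X3,ZX1,X) vanishes, since g and S violate the printed condition; m and b are nonzero, and B2 is nonzero in (v) and (viii). *)

(* Defs.v *)
From HB Require Import structures.
From mathcomp Require Import all_boot all_order all_algebra.
From mathcomp Require Import all_classical all_reals all_analysis.
Import Order.TTheory GRing.Theory Num.Theory.
Import numFieldNormedType.Exports.

Set Implicit Arguments.
Unset Strict Implicit.
Unset Printing Implicit Defensive.

Local Open Scope classical_set_scope.
Local Open Scope ring_scope.

(* Tensor calculus in one coordinate chart of R^n.  Points are row vectors of
   coordinates.  At a point, a (0,2)-tensor is its component matrix, a
   (0,4)-tensor its component function, and a tangent vector a row vector of
   components.  Coordinate indices start at 0, so the index i of 'I_n is the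
   index i + 1 of the usual numbering x^1, ..., x^n. *)

Section Chart.
Context {R : realType} {n : nat}.

Definition tensor4 := 'I_n -> 'I_n -> 'I_n -> 'I_n -> R.

Definition partial (i : 'I_n) (f : 'rV[R]_n -> R) (x : 'rV[R]_n) : R :=
  'D_(delta_mx ord0 i : 'rV[R]_n) f x.

(* For open U this is C^oo on U: all iterated partial derivatives exist and
   are differentiable at every point of U. *)
Definition smooth_on (U : set 'rV[R]_n) (f : 'rV[R]_n -> R) : Prop :=
  forall (s : seq 'I_n) (x : 'rV[R]_n), U x ->
    differentiable (foldr partial f s) x.

Section Curvature.
Variable g : 'rV[R]_n -> 'M[R]_n.

(* christoffel k i j x is Gamma^k_{ij} at x. *)
Definition christoffel (k i j : 'I_n) (x : 'rV[R]_n) : R :=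
  2^-1 * \sum_l invmx (g x) k l *
    (partial i (fun y => g y j l) x + partial j (fun y => g y i l) x
     - partial l (fun y => g y i j) x).

(* riemann13 p q u v x is R^p_{q u v}, the dx^p-component of
   (nabla_u nabla_v - nabla_v nabla_u) (d/dx^q). *)
Definition riemann13 (p q u v : 'I_n) (x : 'rV[R]_n) : R :=
  partial u (christoffel p v q) x - partial v (christoffel p u q) x
  + \sum_l (christoffel p u l x * christoffel l v q x
            - christoffel p v l x * christoffel l u q x).

(* With this sign, R_{pqpq} > 0 in positive curvature. *)
Definition riemann (x : 'rV[R]_n) : tensor4 := fun p q u v =>
  \sum_l g x p l * riemann13 l q u v x.

(* The contraction of the outer slots 1 and 4; combined with the sign of
   riemann, S is the opposite of the most common Ricci tensor. *)
Definition ricci (x : 'rV[R]_n) : 'M[R]_n :=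
  \matrix_(q, u) \sum_p \sum_v invmx (g x) p v * riemann x p q u v.

Definition scalar_curvature (x : 'rV[R]_n) : R :=
  \sum_q \sum_u invmx (g x) q u * ricci x q u.

(* covariant4 T x s p q u v is (nabla_s T)_{pquv} at x. *)
Definition covariant4 (T : 'rV[R]_n -> tensor4) (x : 'rV[R]_n)
    (s p q u v : 'I_n) : R :=
  partial s (fun y => T y p q u v) x
  - \sum_l (christoffel l s p x * T x l q u v
            + christoffel l s q x * T x p l u v
            + christoffel l s u x * T x p q l v
            + christoffel l s v x * T x p q u l).

Definition kulkarni_nomizu (A U : 'M[R]_n) : tensor4 := fun p q u v =>
  A p v * U q u - A p u * U q v + A q u * U p v - A q v * U p u.

Definition conformal (x : 'rV[R]_n) : tensor4 := fun p q u v =>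
  riemann x p q u v
  - (n%:R - 2)^-1 * kulkarni_nomizu (g x) (ricci x) p q u v
  + scalar_curvature x / (2 * (n%:R - 1) * (n%:R - 2))
    * kulkarni_nomizu (g x) (g x) p q u v.

Definition concircular (x : 'rV[R]_n) : tensor4 := fun p q u v =>
  riemann x p q u v
  - scalar_curvature x / (2 * n%:R * (n%:R - 1))
    * kulkarni_nomizu (g x) (g x) p q u v.

Definition conharmonic (x : 'rV[R]_n) : tensor4 := fun p q u v =>
  riemann x p q u v
  - (n%:R - 2)^-1 * kulkarni_nomizu (g x) (ricci x) p q u v.

Definition projective (x : 'rV[R]_n) : tensor4 := fun p q u v =>
  riemann x p q u v
  - (n%:R - 1)^-1 * (g x p v * ricci x q u - g x q v * ricci x p u).

End Curvature.

(* From here on, G is the value of the metric at a point. *)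

(* dot_k G T H is the (0,k+2)-tensor T.H, with arguments q_1 ... q_k nu mu. *)
Definition dot2 (G : 'M[R]_n) (T : tensor4) (H : 'M[R]_n)
    (q1 q2 nu mu : 'I_n) : R :=
  - \sum_p \sum_r invmx G p r *
      (T mu nu q1 r * H p q2 + T mu nu q2 r * H q1 p).

Definition dot4 (G : 'M[R]_n) (T H : tensor4)
    (q1 q2 q3 q4 nu mu : 'I_n) : R :=
  - \sum_p \sum_r invmx G p r *
      (T mu nu q1 r * H p q2 q3 q4 + T mu nu q2 r * H q1 p q3 q4
       + T mu nu q3 r * H q1 q2 p q4 + T mu nu q4 r * H q1 q2 q3 p).

Definition tachibana2 (Z H : 'M[R]_n) (q1 q2 nu mu : 'I_n) : R :=
  Z mu q1 * H nu q2 + Z mu q2 * H q1 nu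
  - Z nu q1 * H mu q2 - Z nu q2 * H q1 mu.

Definition tachibana4 (Z : 'M[R]_n) (H : tensor4)
    (q1 q2 q3 q4 nu mu : 'I_n) : R :=
  Z mu q1 * H nu q2 q3 q4 + Z mu q2 * H q1 nu q3 q4
  + Z mu q3 * H q1 q2 nu q4 + Z mu q4 * H q1 q2 q3 nu
  - Z nu q1 * H mu q2 q3 q4 - Z nu q2 * H q1 mu q3 q4
  - Z nu q3 * H q1 q2 mu q4 - Z nu q4 * H q1 q2 q3 mu.

(* T.H = L Q(g,H) for a (0,2)-tensor, resp. (0,4)-tensor, H. *)
Definition pseudosymmetric2 (G : 'M[R]_n) (T : tensor4) (H : 'M[R]_n)
    (L : R) : Prop :=
  forall q1 q2 nu mu,
    dot2 G T H q1 q2 nu mu = L * tachibana2 G H q1 q2 nu mu.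

Definition pseudosymmetric4 (G : 'M[R]_n) (T H : tensor4) (L : R) : Prop :=
  forall q1 q2 q3 q4 nu mu,
    dot4 G T H q1 q2 q3 q4 nu mu = L * tachibana4 G H q1 q2 q3 q4 nu mu.

(* The matrix of the endomorphism ZZ with g(ZZ X, Y) = Z(X, Y), acting on row
   vectors on the right: (X *m endo G Z) *m G *m Y^T = X *m Z *m Y^T. *)
Definition endo (G Z : 'M[R]_n) : 'M[R]_n := Z *m invmx G.

(* S^2(X, Y) = S(JJ X, Y), where JJ is the endomorphism of S. *)
Definition square2 (G S : 'M[R]_n) : 'M[R]_n := endo G S *m S.

Definition eval1 (w X : 'rV[R]_n) : R := \sum_i w ord0 i * X ord0 i.

Definition eval4 (T : tensor4) (X Y V W : 'rV[R]_n) : R :=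
  \sum_i \sum_j \sum_k \sum_l
    T i j k l * X ord0 i * Y ord0 j * V ord0 k * W ord0 l.

Definition compatible (G : 'M[R]_n) (T : tensor4) (Z : 'M[R]_n) : Prop :=
  forall X X1 X2 X3 : 'rV[R]_n,
    eval4 T (X1 *m endo G Z) X X2 X3
    + eval4 T (X2 *m endo G Z) X X3 X1
    + eval4 T (X3 *m endo G Z) X X1 X2 = 0.

(* The cyclic sum in compatible puts X2, X3 in the last two slots and needs T to
   be skew there.  The projective tensor is skew only in its first two slots,
   so its compatibility has to be expressed with T(X2, X3, ZZ X1, X) instead of
   T(ZZ X1, X, X2, X3); with the latter, g itself is compatible with it only if
   g is Einstein.  Both agree when T(X, Y, V, W) = T(V, W, X, Y). *)
Definition swap_pairs (T : tensor4) : tensor4 := fun p q u v => T u v p q.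

(* Recurrence at x of the curvature 2-forms of T for the 1-form w; the first
   argument of eval5 is the direction of differentiation. *)
Definition eval5 (D : 'I_n -> tensor4) (X1 X2 X3 X4 X5 : 'rV[R]_n) : R :=
  \sum_s X1 ord0 s * eval4 (D s) X2 X3 X4 X5.

Definition recurrent_2forms (g : 'rV[R]_n -> 'M[R]_n)
    (T : 'rV[R]_n -> tensor4) (w x : 'rV[R]_n) : Prop :=
  forall X1 X2 X3 X4 X5 : 'rV[R]_n,
    eval5 (covariant4 g T x) X1 X2 X3 X4 X5
    + eval5 (covariant4 g T x) X2 X3 X1 X4 X5
    + eval5 (covariant4 g T x) X3 X1 X2 X4 X5
    = eval1 w X1 * eval4 (T x) X2 X3 X4 X5
      + eval1 w X2 * eval4 (T x) X3 X1 X4 X5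
      + eval1 w X3 * eval4 (T x) X1 X2 X4 X5.

(* w1 (x) w2 *)
Definition tensor_product (w1 w2 : 'rV[R]_n) : 'M[R]_n := w1^T *m w2.

End Chart.

Arguments tensor4 : clear implicits.

Section Hayward.
Context {R : realType}.
Variables m b : R.

(* The coordinates are (t, r, theta, phi). *)
Definition coord_r (x : 'rV[R]_4) : R := x 0 1.
Definition coord_theta (x : 'rV[R]_4) : R := x 0 2.

Definition row4 (a0 a1 a2 a3 : R) : 'rV[R]_4 :=
  \row_j [:: a0; a1; a2; a3]`_j.

Definition hayB (r : R) : R := 2 * b ^+ 2 * m + r ^+ 2 * (r - 2 * m).
Definition hayB1 (r : R) : R := 2 * b ^+ 2 * m + r ^+ 3.
Definition hayB2 (r : R) : R := 4 * b ^+ 2 * m - r ^+ 3.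
Definition hayB3 (r : R) : R := b ^+ 2 * m - r ^+ 3.

Definition hayward (x : 'rV[R]_4) : 'M[R]_4 :=
  let r := coord_r x in
  diag_mx (row4 (- (hayB r / hayB1 r)) (hayB1 r / hayB r)
                (r ^+ 2) (r ^+ 2 * sin (coord_theta x) ^+ 2)).

(* The points at which these coordinates give a nondegenerate metric. *)
Definition hayward_domain : set 'rV[R]_4 := [set x |
  [/\ 0 < coord_r x, 0 < coord_theta x < pi,
      hayB (coord_r x) != 0 & hayB1 (coord_r x) != 0]].

(* The matrices diag([z11 z12; z12 z22], [z33 z34; z34 z44]). *)
Definition block_form (Z : 'M[R]_4) : Prop :=
  exists z11 z12 z22 z33 z34 z44 : R,
    Z = \matrix_(i, j) (nth [::] [:: [:: z11; z12; 0; 0];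
                                     [:: z12; z22; 0; 0];
                                     [:: 0; 0; z33; z34];
                                     [:: 0; 0; z34; z44]] i)`_j.

(* T is a (0,4)-tensor field.  Compatibility is a condition on tensor fields:
   for a single Z at a single point it may be weaker than block_form (e.g. it
   is void for the conformal tensor where hayB2 vanishes). *)
Definition compatible_iff_block (T : 'rV[R]_4 -> tensor4 R 4) : Prop :=
  forall Z : 'rV[R]_4 -> 'M[R]_4,
    (forall i j, smooth_on hayward_domain (fun x => Z x i j)) ->
    (forall x, hayward_domain x -> compatible (hayward x) (T x) (Z x)) <->
    (forall x, hayward_domain x -> block_form (Z x)).

End Hayward.

(* Main.v *)
Require Import Defs.
From HB Require Import structures.
From mathcomp Require Import all_boot all_order all_algebra.
From mathcomp Require Import all_classical all_reals all_analysis.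
From mathcomp Require Import ring.
Import Order.TTheory GRing.Theory Num.Theory.
Import numFieldNormedType.Exports.

Set Implicit Arguments.
Unset Strict Implicit.
Unset Printing Implicit Defensive.

Local Open Scope classical_set_scope.
Local Open Scope ring_scope.

(** The metric is static and spherically symmetric: -f dt^2 + dr^2 / f + r^2 dOmega^2
with f = B / B_1.  Hence its Riemann tensor is diagonal on coordinate planes:
R_{pquv} = k_{pq} (g_{pu} g_{qv} - g_{pv} g_{qu}), where k takes one value a on the
(t, r)-plane, one value e on the (theta, phi)-plane and one value d on the four
mixed planes; C, W, K have the same shape, and P and S a similar one.  For T of
this shape T.H = - k_{mu nu} Q(g, H), while Q(g, H)_{..nu mu} vanishes when nu and
mu lie in the same block and H is built from the two blocks of g.  So only the
value d on mixed planes matters, which gives (i)-(iv); the remaining algebraic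
items are identities between a, d, e.

For (viii), C = psi (g ^ g - 3 g ^ h + 3 h ^ h), where h is the angular part of g,
and nabla_s h_{pq} = - (dr_p h_{sq} + dr_q h_{sp}) / r.

For (xiii), compatibility reads Z_{iu} k_{uv} = Z_{ui} k_{iv} for v distinct from i
and u.  This forces the block form wherever d1, d2 and d1 d2 - a e do not vanish
(d1, d2 being the values of k on the two kinds of mixed ordered pairs), that is off
the roots of a nonzero polynomial in r, and then everywhere by continuity. *)

(** * Tensors of sectional type for a metric *)

(** For constant [k] this is the tensor of constant curvature [k] in the sign convention of
    [riemann]. [k] may be nonsymmetric, which makes room for the projective tensor after
    [swap_pairs]. *)
Definition sectional (R : realType) (n : nat) (G : 'M[R]_n)
    (k : 'I_n -> 'I_n -> R) : tensor4 R n :=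
  fun p q u v => k p q * (G p u * G q v - G p v * G q u).

Lemma contract_metric (R : realType) (n : nat) (G : 'M[R]_n) a (F : 'I_n -> R) :
  G \in unitmx -> G^T = G ->
  \sum_p \sum_r invmx G p r * (G a r * F p) = F a.
Proof.
move=> uG sG; have symG i j : G i j = G j i by rewrite -{1}sG mxE.
transitivity (\sum_p (p == a)%:R * F p).
  apply: eq_bigr => p _; rewrite -[(p == a)%:R](_ : (invmx G *m G) p a = _).
    by rewrite mxE big_distrl; apply: eq_bigr => r _ /=; rewrite (symG a r); ring.
  by rewrite mulVmx // mxE.
by rewrite (bigD1 a) //= eqxx mul1r big1 ?addr0 // => p /negbTE->; rewrite mul0r.
Qed.

(** The last slot of [sectional G k] enters only through entries of [G], so raising it with the
    inverse metric cancels against them. *)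
Lemma contract_sectional (R : realType) (n : nat) (G : 'M[R]_n) k mu nu q
    (F : 'I_n -> R) :
  G \in unitmx -> G^T = G ->
  \sum_p \sum_r invmx G p r * (sectional G k mu nu q r * F p)
  = k mu nu * (G mu q * F nu - G nu q * F mu).
Proof.
move=> uG sG; have symG i j : G i j = G j i by rewrite -{1}sG mxE.
rewrite -(contract_metric nu F uG sG) -[in X in _ - X](contract_metric mu F uG sG).
rewrite /sectional !big_distrr /= -sumrB.
rewrite big_distrr /=; apply: eq_bigr => p _.
rewrite !big_distrr /= -sumrB big_distrr /=; apply: eq_bigr => r _.
by rewrite (symG nu q); ring.
Qed.

Lemma dot4_sectional (R : realType) (n : nat) (G : 'M[R]_n) k H q1 q2 q3 q4 nu mu :
  G \in unitmx -> G^T = G ->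
  dot4 G (sectional G k) H q1 q2 q3 q4 nu mu
  = - k mu nu * tachibana4 G H q1 q2 q3 q4 nu mu.
Proof.
move=> uG sG; rewrite /dot4 /tachibana4.
under eq_bigr do under eq_bigr do rewrite !mulrDr.
under eq_bigr do rewrite !big_split.
rewrite !big_split /=.
rewrite (contract_sectional k mu nu q1 (fun p => H p q2 q3 q4)) //.
rewrite (contract_sectional k mu nu q2 (fun p => H q1 p q3 q4)) //.
rewrite (contract_sectional k mu nu q3 (fun p => H q1 q2 p q4)) //.
rewrite (contract_sectional k mu nu q4 (fun p => H q1 q2 q3 p)) //.
ring.
Qed.

Lemma dot2_sectional (R : realType) (n : nat) (G : 'M[R]_n) k H q1 q2 nu mu :
  G \in unitmx -> G^T = G ->
  dot2 G (sectional G k) H q1 q2 nu mu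
  = - k mu nu * tachibana2 G H q1 q2 nu mu.
Proof.
move=> uG sG; rewrite /dot2 /tachibana2.
under eq_bigr do under eq_bigr do rewrite !mulrDr.
under eq_bigr do rewrite !big_split.
rewrite !big_split /=.
rewrite (contract_sectional k mu nu q1 (fun p => H p q2)) //.
rewrite (contract_sectional k mu nu q2 (fun p => H q1 p)) //.
ring.
Qed.

Section Contractions.
Variables (R : realType) (n : nat) (G : 'M[R]_n).
Hypotheses (uG : G \in unitmx) (sG : G^T = G).

Let symG i j : G i j = G j i.
Proof. by rewrite -{1}sG mxE. Qed.

(** The first product of metric entries contributes only at p = q and the second contributes the
    full trace, so the terms with p = q cancel: what remains is minus the sum of [k p q] over p
    distinct from q. *)
Lemma ricci_contraction k q u :
  \sum_p \sum_v invmx G p v * sectional G k p q u v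
  = (k q q - \sum_p k p q) * G q u.
Proof.
have inv p i : \sum_v invmx G p v * G i v = (p == i)%:R.
  rewrite -[RHS](_ : (invmx G *m G) p i = _); last by rewrite mulVmx ?mxE.
  by rewrite mxE; apply: eq_bigr => v _; rewrite (symG i v).
transitivity (\sum_p (k p q * G p u * (p == q)%:R - k p q * G q u)).
  apply: eq_bigr => p _; rewrite -[X in _ - X]mulr1 -[in RHS](inv p q).
  have -> : 1 = \sum_v invmx G p v * G p v by rewrite inv eqxx.
  rewrite !big_distrr /= -sumrB; apply: eq_bigr => v _; rewrite /sectional; ring.
rewrite sumrB -big_distrl /= mulrBl; congr (_ - _).
rewrite (bigD1 q) //= eqxx mulr1 big1 ?addr0 // => p pq.
by rewrite (negbTE pq) mulr0.
Qed.

Lemma trace_contraction (z : 'I_n -> R) :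
  \sum_q \sum_u invmx G q u * (z q * G q u) = \sum_q z q.
Proof.
apply: eq_bigr => q _; rewrite -[RHS]mulr1.
have <- : (invmx G *m G) q q = 1 by rewrite mulVmx ?mxE ?eqxx.
rewrite mxE big_distrr; apply: eq_bigr => u _ /=; rewrite (symG q u); ring.
Qed.

End Contractions.

(** * Metrics split into two blocks of two coordinates *)

Lemma sum_ord4 (R : realType) (F : 'I_4 -> R) :
  \sum_i F i = F (Ordinal (isT : (0 < 4)%N)) + F (Ordinal (isT : (1 < 4)%N))
    + F (Ordinal (isT : (2 < 4)%N)) + F (Ordinal (isT : (3 < 4)%N)).
Proof.
rewrite !big_ord_recl big_ord0 addr0 !addrA.
by congr (F _ + F _ + F _ + F _); apply: val_inj.
Qed.

Lemma ord4P (k : 'I_4) :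
  [\/ k = Ordinal (isT : (0 < 4)%N), k = Ordinal (isT : (1 < 4)%N),
      k = Ordinal (isT : (2 < 4)%N) | k = Ordinal (isT : (3 < 4)%N)].
Proof.
case: k => [[|[|[|[|//]]]] ?];
  [apply: Or41|apply: Or42|apply: Or43|apply: Or44]; exact: val_inj.
Qed.

(** The blocks are {t, r} and {theta, phi}. The two mixed values are kept apart because those of P
    differ. *)
Definition blockwise (R : realType) (a d1 d2 e : R) (p q : 'I_4) : R :=
  if (p < 2)%N then if (q < 2)%N then a else d1
  else if (q < 2)%N then d2 else e.

(* All curvature tensors in play have this shape; unlike sectional it does not
   force the symmetry T_{pquv} = T_{uvpq}, which P lacks. *)
Definition block_product (R : realType) (G : 'M[R]_4)
    (X : 'I_4 -> 'I_4 -> R) : tensor4 R 4 :=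
  fun p q u v => X p q * (G p v * G q u) - X q p * (G q v * G p u).

(** When [G] has no entries between the blocks, these are the combinations z1 A + z2 B of its two
    block projections; the Ricci tensor and its square are of this form. *)
Definition block_scale (R : realType) (G : 'M[R]_4) (z1 z2 : R) : 'M[R]_4 :=
  \matrix_(i, j) ((if (i < 2)%N then z1 else z2) * G i j).

Lemma block_scaleE (R : realType) (G : 'M[R]_4) z1 z2 i j :
  block_scale G z1 z2 i j = (if (i < 2)%N then z1 else z2) * G i j.
Proof. exact: mxE. Qed.

(** The product takes the slot pairing (p v)(q u) with a plus sign, opposite to [sectional]; hence
    the minus signs, and the value -2 for g ^ g on every plane. *)
Lemma kulkarni_nomizu_block_scale (R : realType) (G : 'M[R]_4) z1 z2 w1 w2 :
  kulkarni_nomizu (block_scale G z1 z2) (block_scale G w1 w2)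
  = sectional G (blockwise (- 2 * (z1 * w1)) (- (z1 * w2 + z2 * w1))
                           (- (z1 * w2 + z2 * w1)) (- 2 * (z2 * w2))).
Proof.
apply/funext => p; apply/funext => q; apply/funext => u; apply/funext => v.
rewrite /kulkarni_nomizu /sectional /blockwise !mxE.
case: (p < 2)%N; case: (q < 2)%N; ring.
Qed.

Lemma block_scale1 (R : realType) (G : 'M[R]_4) : block_scale G 1 1 = G.
Proof. by apply/matrixP => i j; rewrite mxE if_same mul1r. Qed.

Lemma sectional_block_product (R : realType) (G : 'M[R]_4) a d e :
  sectional G (blockwise a d d e)
  = block_product G (blockwise (- a) (- d) (- d) (- e)).
Proof.
apply/funext => p; apply/funext => q; apply/funext => u; apply/funext => v.
rewrite /sectional /block_product /blockwise.
case: (p < 2)%N; case: (q < 2)%N; ring.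
Qed.

Lemma block_formP (R : realType) (Z : 'M[R]_4) :
  block_form Z <-> (forall i j, Z i j = Z j i)
    /\ (forall i j : 'I_4, (i < 2)%N != (j < 2)%N -> Z i j = 0).
Proof.
split=> [[z11 [z12 [z22 [z33 [z34 [z44 ->]]]]]]|[Zsym Z0]].
  by split=> i j; rewrite !mxE;
    case: i => [[|[|[|[|//]]]] ?]; case: j => [[|[|[|[|//]]]] ?].
pose o k (lt4 : (k < 4)%N) := Ordinal lt4.
exists (Z (o 0 isT) (o 0 isT)), (Z (o 0 isT) (o 1 isT)), (Z (o 1 isT) (o 1 isT)),
  (Z (o 2 isT) (o 2 isT)), (Z (o 2 isT) (o 3 isT)), (Z (o 3 isT) (o 3 isT)).
apply/matrixP => i j; rewrite mxE.
by case: (ord4P i) => ->; case: (ord4P j) => -> /=;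
  try reflexivity; try exact: Zsym; exact: Z0.
Qed.

(** * Curvature tensors at a point from the three sectional curvatures *)

Section PointwiseCurvature.
Variables (R : realType) (g : 'rV[R]_4 -> 'M[R]_4) (x : 'rV[R]_4) (a d e : R).
Hypotheses (g_unit : g x \in unitmx) (g_sym : (g x)^T = g x).
Hypothesis riemannE : riemann g x = sectional (g x) (blockwise a d d e).

(** A direction of the first block lies in one plane of curvature a and two mixed planes, one of the
    second block in one plane of curvature e and two mixed planes. The sign is that of [ricci]. *)
Lemma ricciE : ricci g x = block_scale (g x) (- (a + 2 * d)) (- (2 * d + e)).
Proof.
apply/matrixP => q u; rewrite !mxE riemannE ricci_contraction // sum_ord4.
rewrite /blockwise /=.
by case: (q < 2)%N; ring.
Qed.

Lemma scalar_curvatureE : scalar_curvature g x = - 2 * (a + 4 * d + e).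
Proof.
rewrite /scalar_curvature ricciE.
under eq_bigr do under eq_bigr do rewrite mxE.
rewrite (trace_contraction g_unit g_sym
  (fun q : 'I_4 => if (q < 2)%N then - (a + 2 * d) else - (2 * d + e))).
rewrite sum_ord4 /=; ring.
Qed.

Let gg : kulkarni_nomizu (g x) (g x) = sectional (g x) (blockwise (-2) (-2) (-2) (-2)).
Proof.
rewrite -{1 2}(block_scale1 (g x)) kulkarni_nomizu_block_scale.
congr (sectional _ (blockwise _ _ _ _)); ring.
Qed.

Let gS : kulkarni_nomizu (g x) (ricci g x)
  = sectional (g x) (blockwise (2 * (a + 2 * d)) (a + 4 * d + e)
                               (a + 4 * d + e) (2 * (2 * d + e))).
Proof.
rewrite -{1}(block_scale1 (g x)) ricciE kulkarni_nomizu_block_scale.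
congr (sectional _ (blockwise _ _ _ _)); ring.
Qed.

Let natr4B2 : 4%:R - 2 = 2 :> R. Proof. ring. Qed.
Let natr4B1 : 4%:R - 1 = 3 :> R. Proof. ring. Qed.

(** C is trace-free, so its values satisfy a + 2 d = 0 = 2 d + e and a single parameter,
    proportional to a + e - 2 d, survives. *)
Lemma conformalE : conformal g x =
  sectional (g x) (blockwise ((a + e - 2 * d) / 3) (- ((a + e - 2 * d) / 6))
                     (- ((a + e - 2 * d) / 6)) ((a + e - 2 * d) / 3)).
Proof.
apply/funext => p; apply/funext => q; apply/funext => u; apply/funext => v.
rewrite /conformal natr4B1 natr4B2 scalar_curvatureE gg gS riemannE /sectional /blockwise.
by case: (p < 2)%N; case: (q < 2)%N; field.
Qed.

Lemma concircularE : concircular g x =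
  sectional (g x) (blockwise ((5 * a - 4 * d - e) / 6) (- ((a + e - 2 * d) / 6))
                     (- ((a + e - 2 * d) / 6)) ((5 * e - 4 * d - a) / 6)).
Proof.
apply/funext => p; apply/funext => q; apply/funext => u; apply/funext => v.
rewrite /concircular natr4B1 scalar_curvatureE gg riemannE /sectional /blockwise.
by case: (p < 2)%N; case: (q < 2)%N; field.
Qed.

Lemma conharmonicE : conharmonic g x =
  sectional (g x) (blockwise (- 2 * d) (- ((a + 2 * d + e) / 2))
                             (- ((a + 2 * d + e) / 2)) (- 2 * d)).
Proof.
apply/funext => p; apply/funext => q; apply/funext => u; apply/funext => v.
rewrite /conharmonic natr4B2 gS riemannE /sectional /blockwise.
by case: (p < 2)%N; case: (q < 2)%N; field.
Qed.

(** Only half of a Kulkarni-Nomizu product is subtracted from R, so the values on the two mixed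
    ordered pairs differ and [sectional] does not apply. *)
Lemma projectiveE : projective g x =
  block_product (g x) (blockwise (- (2 * (a - d) / 3)) ((e - d) / 3)
                                 ((a - d) / 3) (- (2 * (e - d) / 3))).
Proof.
apply/funext => p; apply/funext => q; apply/funext => u; apply/funext => v.
rewrite /projective natr4B1 ricciE riemannE /sectional /block_product /blockwise !mxE.
by case: (p < 2)%N; case: (q < 2)%N; field.
Qed.

End PointwiseCurvature.

Lemma invmx_diag (R : realType) (n : nat) (G : 'M[R]_n) i j :
  is_diag_mx G -> G \in unitmx -> invmx G i j = (G i i)^-1 *+ (i == j).
Proof.
move=> G_diag uG.
have G0 k l : k != l -> G k l = 0 by move=> kl; exact: (is_diag_mxP G_diag).
have := mulVmx uG => /matrixP/(_ i j); rewrite !mxE (bigD1 j) //= big1 ?addr0.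
  move=> h; have Gj : G j j != 0.
    apply/eqP => Gj0; have := mulVmx uG => /matrixP/(_ j j).
    rewrite !mxE (bigD1 j) //= Gj0 mulr0 add0r big1.
      by move/esym/eqP; rewrite eqxx oner_eq0.
    by move=> k kj; rewrite G0 ?mulr0 // eq_sym.
  rewrite -[LHS](mulfK Gj) h; case: eqVneq => [->|_] /=; last by rewrite mul0r.
  by rewrite mul1r.
by move=> k kj; rewrite G0 ?mulr0.
Qed.

(** * Compatibility in components *)

Section Multilinear.
Variables (R : realType) (n : nat).
Implicit Types (T : tensor4 R n) (X : 'rV[R]_n).

Lemma eval4_mull T (E : 'M[R]_n) X1 X2 X3 X4 :
  eval4 T (X1 *m E) X2 X3 X4
  = eval4 (fun i j k l => \sum_p E i p * T p j k l) X1 X2 X3 X4.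
Proof.
rewrite /eval4; under eq_bigr do under eq_bigr do under eq_bigr do
  under eq_bigr do rewrite mxE big_distrr /= 3!big_distrl /=.
under eq_bigr do under eq_bigr do under eq_bigr do rewrite exchange_big.
under eq_bigr do under eq_bigr do rewrite exchange_big.
under eq_bigr do rewrite exchange_big.
rewrite exchange_big; apply: eq_bigr => i _.
rewrite exchange_big; apply: eq_bigr => j _.
rewrite exchange_big; apply: eq_bigr => k _.
rewrite exchange_big; apply: eq_bigr => l _.
rewrite !big_distrl; apply: eq_bigr => p _ /=; ring.
Qed.

(** Cyclic rotation of slots 1, 3 and 4 with slot 2 fixed: applied once or twice, it brings the
    terms of the compatibility condition to a common order of arguments. *)
Lemma eval4_rot T X1 X2 X3 X4 :
  eval4 T X2 X4 X3 X1 = eval4 (fun i j k l => T k j l i) X1 X4 X2 X3.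
Proof.
rewrite /eval4; under eq_bigr do under eq_bigr do rewrite exchange_big.
under eq_bigr do rewrite exchange_big.
rewrite exchange_big [LHS]/=.
transitivity (\sum_l \sum_i \sum_j \sum_k
    T i j k l * X2 ord0 i * X4 ord0 j * X3 ord0 k * X1 ord0 l) => //.
apply: eq_bigr => i _; rewrite exchange_big; apply: eq_bigr => j _.
apply: eq_bigr => k _; apply: eq_bigr => l _; ring.
Qed.

Lemma eval4D T T' X1 X2 X3 X4 :
  eval4 T X1 X2 X3 X4 + eval4 T' X1 X2 X3 X4
  = eval4 (fun i j k l => T i j k l + T' i j k l) X1 X2 X3 X4.
Proof.
rewrite /eval4 -big_split; apply: eq_bigr => i _ /=.
rewrite -big_split; apply: eq_bigr => j _ /=.
rewrite -big_split; apply: eq_bigr => k _ /=.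
rewrite -big_split; apply: eq_bigr => l _ /=.
by rewrite !mulrDl.
Qed.

Lemma eval4_delta T i j k l :
  eval4 T (delta_mx ord0 i) (delta_mx ord0 j) (delta_mx ord0 k)
    (delta_mx ord0 l) = T i j k l.
Proof.
rewrite /eval4 (bigD1 i) //= (bigD1 j) //= (bigD1 k) //= (bigD1 l) //=.
rewrite !mxE !eqxx !mulr1 !big1 ?addr0 // => s /negbTE sN.
all: by do ?[rewrite big1 // => ? _]; rewrite !mxE sN andbF !(mulr0, mul0r).
Qed.

Lemma eval4_eq0 T : (forall i j k l, T i j k l = 0) ->
  forall X1 X2 X3 X4, eval4 T X1 X2 X3 X4 = 0.
Proof.
move=> T0 X1 X2 X3 X4; rewrite /eval4 big1 // => i _; rewrite big1 // => j _.
by rewrite big1 // => k _; rewrite big1 // => l _; rewrite T0 !mul0r.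
Qed.

Lemma compatibleP (G : 'M[R]_n) T (Z : 'M[R]_n) :
  compatible G T Z <->
  forall i q u v, \sum_p endo G Z i p * T p q u v
    + \sum_p endo G Z u p * T p q v i + \sum_p endo G Z v p * T p q i u = 0.
Proof.
set U := fun i q u v : 'I_n => \sum_p endo G Z i p * T p q u v
    + \sum_p endo G Z u p * T p q v i + \sum_p endo G Z v p * T p q i u.
have UE X X1 X2 X3 : eval4 T (X1 *m endo G Z) X X2 X3
    + eval4 T (X2 *m endo G Z) X X3 X1 + eval4 T (X3 *m endo G Z) X X1 X2
    = eval4 U X1 X X2 X3.
  rewrite !eval4_mull -eval4D -eval4D; congr (_ + _ + _).
    by rewrite eval4_rot.
  by rewrite eval4_rot eval4_rot.
split=> [h i q u v|U0 X X1 X2 X3]; last by rewrite UE; exact: eval4_eq0.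
have := h (delta_mx ord0 q) (delta_mx ord0 i) (delta_mx ord0 u) (delta_mx ord0 v).
by rewrite UE eval4_delta.
Qed.

End Multilinear.

(** * Pseudosymmetry and compatibility for a diagonal metric with two blocks *)

Section TwoBlocks.
Context {R : realType}.
Variable G : 'M[R]_4.
Hypotheses (G_diag : is_diag_mx G) (uG : G \in unitmx).

Let G_sym i j : G i j = G j i.
Proof.
case: (eqVneq i j) => [->//|ij].
by rewrite !(is_diag_mxP G_diag) // eq_sym.
Qed.

Let sG : G^T = G.
Proof. by apply/matrixP => i j; rewrite mxE G_sym. Qed.

Let G_block (i j : 'I_4) : (i < 2)%N != (j < 2)%N -> G i j = 0.
Proof.
move=> ij; apply: (is_diag_mxP G_diag); apply: contraNneq ij => ij.
by rewrite (val_inj ij).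
Qed.

(** Q(g, H) with last indices nu, mu is the action on H of the infinitesimal rotation of the (nu,
    mu)-plane. A rotation inside one block preserves both block projections of [G], hence every
    tensor built from them. *)
Lemma tachibana4_block_product (a d1 d2 e : R) (q1 q2 q3 q4 nu mu : 'I_4) :
  (nu < 2)%N = (mu < 2)%N ->
  tachibana4 G (block_product G (blockwise a d1 d2 e)) q1 q2 q3 q4 nu mu = 0.
Proof.
move=> same; rewrite /tachibana4 /block_product /blockwise same.
rewrite (G_sym q1 nu) (G_sym q1 mu) (G_sym q2 nu) (G_sym q2 mu).
have nu0 (q : 'I_4) : (q < 2)%N != (mu < 2)%N -> G nu q = 0.
  by move=> h; apply: G_block; rewrite same eq_sym.
have mu0 (q : 'I_4) : (q < 2)%N != (mu < 2)%N -> G mu q = 0.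
  by move=> h; apply: G_block; rewrite eq_sym.
move: (nu0 q1) (nu0 q2) (nu0 q3) (nu0 q4) (mu0 q1) (mu0 q2) (mu0 q3) (mu0 q4).
case: (mu < 2)%N; case: (q1 < 2)%N; case: (q2 < 2)%N;
  case: (q3 < 2)%N; case: (q4 < 2)%N => /=.
(* For each of the eight facts: the metric entry is rewritten to 0 if its indices lie in different
   blocks, and the fact is dropped otherwise. *)
all: do 8![move=> /(_ isT) -> || move=> _].
all: ring.
Qed.

Lemma pseudosymmetric4_sectional a d e x11 x12 x21 x22 :
  pseudosymmetric4 G (sectional G (blockwise a d d e))
    (block_product G (blockwise x11 x12 x21 x22)) (- d).
Proof.
move=> q1 q2 q3 q4 nu mu; rewrite dot4_sectional //.
case: (eqVneq (nu < 2)%N (mu < 2)%N) => [same|].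
  by rewrite tachibana4_block_product // !mulr0.
by rewrite /blockwise; case: (mu < 2)%N; case: (nu < 2)%N.
Qed.

Lemma pseudosymmetric2_sectional a d e z1 z2 :
  pseudosymmetric2 G (sectional G (blockwise a d d e)) (block_scale G z1 z2)
    (- d).
Proof.
move=> q1 q2 nu mu; rewrite dot2_sectional // /tachibana2 !mxE /blockwise.
case: (boolP ((nu < 2) == (mu < 2))%N) => [/eqP same|]; last first.
  by case: (mu < 2)%N; case: (nu < 2)%N.
rewrite (G_sym q1 nu) (G_sym q1 mu) same.
have nu0 (q : 'I_4) : (q < 2)%N != (mu < 2)%N -> G nu q = 0.
  by move=> h; apply: G_block; rewrite same eq_sym.
have mu0 (q : 'I_4) : (q < 2)%N != (mu < 2)%N -> G mu q = 0.
  by move=> h; apply: G_block; rewrite eq_sym.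
move: (nu0 q1) (nu0 q2) (mu0 q1) (mu0 q2).
case: (mu < 2)%N; case: (q1 < 2)%N; case: (q2 < 2)%N => /=.
all: do 4![move=> /(_ isT) -> || move=> _].
all: ring.
Qed.

(* For the two block projections A and B of G, the identities Q(A, A ^ A) = 0
   and Q(A, A ^ B) = - Q(B, A ^ A) / 2 leave only two independent tensors. *)
Lemma tachibana4_block_scale z1 z2 a d e q1 q2 q3 q4 nu mu :
  tachibana4 (block_scale G z1 z2) (sectional G (blockwise a d d e))
    q1 q2 q3 q4 nu mu
  = (z2 * a - z1 * d) * tachibana4 (block_scale G 0 1)
      (sectional G (blockwise 1 0 0 0)) q1 q2 q3 q4 nu mu
    + (z2 * d - z1 * e) * tachibana4 (block_scale G 0 1)
      (sectional G (blockwise 0 1 1 0)) q1 q2 q3 q4 nu mu.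
Proof.
rewrite /tachibana4 /sectional /blockwise !mxE.
rewrite (G_sym q1 nu) (G_sym q1 mu) (G_sym q2 nu) (G_sym q2 mu).
move: (@G_block nu q1) (@G_block nu q2) (@G_block nu q3) (@G_block nu q4).
move: (@G_block mu q1) (@G_block mu q2) (@G_block mu q3) (@G_block mu q4).
case: (mu < 2)%N; case: (nu < 2)%N; case: (q1 < 2)%N; case: (q2 < 2)%N;
  case: (q3 < 2)%N; case: (q4 < 2)%N => /=.
all: do 8![move=> /(_ isT) -> || move=> _].
all: ring.
Qed.

Lemma dot2_block_product (X : 'I_4 -> 'I_4 -> R) (H : 'M[R]_4) q1 q2 nu mu :
  dot2 G (block_product G X) H q1 q2 nu mu
  = - (X mu nu * (G nu q1 * H mu q2 + G nu q2 * H q1 mu)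
       - X nu mu * (G mu q1 * H nu q2 + G mu q2 * H q1 nu)).
Proof.
have c q (F : 'I_4 -> R) :
    \sum_p \sum_r invmx G p r * (block_product G X mu nu q r * F p)
    = X mu nu * G nu q * F mu - X nu mu * G mu q * F nu.
  rewrite -(contract_metric mu F uG sG) -(contract_metric nu F uG sG).
  rewrite !big_distrr -sumrB; apply: eq_bigr => p _ /=.
  rewrite !big_distrr -sumrB; apply: eq_bigr => r _ /=.
  by rewrite /block_product; ring.
rewrite /dot2; under eq_bigr do under eq_bigr do rewrite mulrDr.
under eq_bigr do rewrite big_split.
rewrite big_split /= (c q1 (fun p => H p q2)) (c q2 (fun p => H q1 p)); ring.
Qed.

(** Both sides vanish unless nu, mu lie in different blocks and q1, q2 do too. On those entries the
    two sides are the same metric product times the two sides of the scalar hypothesis, up to a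
    common sign. *)
Lemma pseudosymmetric2_block_product x11 x12 x21 x22 z1 z2 L :
  x12 * z1 - x21 * z2 = L * (z1 - z2) ->
  pseudosymmetric2 G (block_product G (blockwise x11 x12 x21 x22))
    (block_scale G z1 z2) L.
Proof.
move=> hL q1 q2 nu mu; rewrite dot2_block_product /tachibana2 !block_scaleE /blockwise.
rewrite (G_sym q1 nu) (G_sym q1 mu).
move: (@G_block nu q1) (@G_block nu q2) (@G_block mu q1) (@G_block mu q2).
case: (mu < 2)%N; case: (nu < 2)%N; case: (q1 < 2)%N; case: (q2 < 2)%N => /=.
all: do 4![move=> /(_ isT) -> || move=> _].
all: try ring.
- transitivity (- (x12 * z1 - x21 * z2) * (G nu q2 * G mu q1)); first ring.
  by rewrite hL; ring.
- transitivity (- (x12 * z1 - x21 * z2) * (G nu q1 * G mu q2)); first ring.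
  by rewrite hL; ring.
- transitivity ((x12 * z1 - x21 * z2) * (G nu q1 * G mu q2)); first ring.
  by rewrite hL; ring.
- transitivity ((x12 * z1 - x21 * z2) * (G nu q2 * G mu q1)); first ring.
  by rewrite hL; ring.
Qed.

Lemma square2_block_scale z1 z2 :
  square2 G (block_scale G z1 z2) = block_scale G (z1 ^+ 2) (z2 ^+ 2).
Proof.
have scaleE w1 w2 : block_scale G w1 w2
    = diag_mx (\row_(i < 4) if (i < 2)%N then w1 else w2) *m G.
  by apply/matrixP => i j; rewrite block_scaleE mul_diag_mx !mxE.
rewrite /square2 /endo {1}scaleE mulmxK //; apply/matrixP => i j.
rewrite mul_diag_mx !mxE; case: (i < 2)%N; ring.
Qed.

Lemma rank_block_scale z : z != 0 -> \rank (block_scale G z 0) = 2%N.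
Proof.
move=> z0; have -> : block_scale G z 0 = z *: (pid_mx 2 *m G).
  apply/matrixP => i j; rewrite block_scaleE !mxE (bigD1 i) //= mxE eqxx.
  rewrite big1 ?addr0; last first.
    move=> k ki; rewrite mxE (_ : (i == k :> nat) = false) ?mul0r //.
    by rewrite eq_sym; exact: negbTE ki.
  by case: (i < 2)%N; rewrite /= ?mul1r ?mul0r ?mulr0.
by rewrite mxrank_scale_nz // mxrankMfree ?row_free_unit // rank_pid_mx.
Qed.

Lemma block_form_block_scale z1 z2 : block_form (block_scale G z1 z2).
Proof.
apply/block_formP; split=> i j; rewrite !block_scaleE.
  case: (eqVneq (i < 2)%N (j < 2)%N) => [->|ij]; first by rewrite G_sym.
  by rewrite !G_block ?mulr0 // eq_sym.
by move=> ij; rewrite G_block ?mulr0.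
Qed.

Let G0 i j : i != j -> G i j = 0.
Proof. by move=> ij; exact: (is_diag_mxP G_diag). Qed.

Lemma diag_unit_neq0 i : G i i != 0.
Proof.
apply/eqP => Gi0; have := mulVmx uG => /matrixP/(_ i i).
rewrite !mxE (bigD1 i) //= Gi0 mulr0 add0r big1.
  by move/esym/eqP; rewrite eqxx oner_eq0.
by move=> k ki; rewrite G0 ?mulr0 // eq_sym.
Qed.

(** For diagonal [G] the endomorphism divides column p of [Z] by [G p p], and each metric factor
    selects one p, whose division it cancels. *)
Lemma endo_sectional k (Z : 'M[R]_4) i q u v :
  \sum_p endo G Z i p * sectional G k p q u v
  = Z i u * k u q * G q v - Z i v * k v q * G q u.
Proof.
have endoE p : endo G Z i p = Z i p / G p p.
  rewrite mxE (bigD1 p) //= invmx_diag // eqxx big1 ?addr0 // => l lp.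
  by rewrite invmx_diag // (negbTE lp) mulr0.
rewrite /sectional.
transitivity (\sum_p (Z i p / G p p * k p q * G q v * G p u
                      - Z i p / G p p * k p q * G q u * G p v)).
  by apply: eq_bigr => p _; rewrite endoE; ring.
rewrite sumrB (bigD1 u) //= [X in _ + X - _]big1; last first.
  by move=> p pu; rewrite (G0 pu) mulr0.
rewrite [in X in _ - X](bigD1 v) //= [X in _ - (_ + X)]big1; last first.
  by move=> p pv; rewrite (G0 pv) mulr0.
have := diag_unit_neq0 u; have := diag_unit_neq0 v => hv hu.
by field; rewrite hu hv.
Qed.

Lemma compatible_block a d1 d2 e Z : block_form Z ->
  compatible G (sectional G (blockwise a d1 d2 e)) Z.
Proof.
move=> [z11 [z12 [z22 [z33 [z34 [z44 ZE]]]]]].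
have Zsym i j : Z i j = Z j i.
  rewrite ZE !mxE.
  by case: i => [[|[|[|[|//]]]] ?]; case: j => [[|[|[|[|//]]]] ?].
have Zblock (i j : 'I_4) : (i < 2)%N != (j < 2)%N -> Z i j = 0.
  rewrite ZE !mxE.
  by case: i => [[|[|[|[|//]]]] ?]; case: j => [[|[|[|[|//]]]] ?].
(* Either i and u share a block, where the rows of [blockwise] agree, or [Z i u] vanishes. The six
   terms then cancel in pairs. *)
have swap i q u : Z i u * blockwise a d1 d2 e u q = Z u i * blockwise a d1 d2 e i q.
  rewrite (Zsym i u); case: (eqVneq (u < 2)%N (i < 2)%N) => [ui|/Zblock ->].
    by rewrite /blockwise ui.
  by rewrite !mul0r.
apply/compatibleP => i q u v; rewrite !endo_sectional.
rewrite (swap i q u) (swap i q v) (swap u q v); ring.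
Qed.

Lemma block_compatible a d1 d2 e Z :
  d1 != 0 -> d2 != 0 -> d1 * d2 != a * e ->
  compatible G (sectional G (blockwise a d1 d2 e)) Z -> block_form Z.
Proof.
move=> d10 d20 det /compatibleP.
set K := blockwise a d1 d2 e => h0.
have h i q u v : (Z i u * K u q * G q v - Z i v * K v q * G q u)
    + (Z u v * K v q * G q i - Z u i * K i q * G q v)
    + (Z v i * K i q * G q u - Z v u * K u q * G q i) = 0.
  by rewrite -!endo_sectional.
(* Setting q = v leaves only the terms containing [G v v], which is nonzero. *)
have step i u v : i != v -> u != v ->
    Z i u * K u v = Z u i * K i v.
  move=> iv uv; apply: (mulIf (diag_unit_neq0 v)).
  have := h i v u v; rewrite (@G0 v i) 1?eq_sym // (@G0 v u) 1?eq_sym // => hv.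
  by apply/eqP; rewrite -subr_eq0; apply/eqP; rewrite -[RHS]hv; ring.
pose o0 : 'I_4 := Ordinal (isT : (0 < 4)%N).
pose o1 : 'I_4 := Ordinal (isT : (1 < 4)%N).
pose o2 : 'I_4 := Ordinal (isT : (2 < 4)%N).
pose o3 : 'I_4 := Ordinal (isT : (3 < 4)%N).
(* Here v and w are the other members of the blocks of i and u. Using each as third index gives two
   linear equations in [Z i u] and [Z u i], with determinant d1 d2 - a e. *)
have mixed (i u v w : 'I_4) : (i < 2)%N -> (2 <= u)%N -> (v < 2)%N -> (2 <= w)%N ->
    v != i -> w != u -> Z i u = 0 /\ Z u i = 0.
  move=> i2 u2 v2 w2 vi wu.
  have uv : u != v by apply: contraTneq u2 => ->; rewrite -ltnNge.
  have iw : i != w by apply: contraTneq i2 => ->; rewrite -leqNgt.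
  have := step i u v; have := step i u w.
  rewrite iw uv (eq_sym i) (eq_sym u w) vi wu /K /blockwise i2 v2.
  rewrite (ltnNge u) u2 (ltnNge w) w2 /= => /(_ isT isT) e1 /(_ isT isT) e2.
  have : Z i u * (d1 * d2 - a * e) = 0.
    transitivity (d1 * (Z i u * d2) - a * (Z i u * e)); first ring.
    by rewrite e1 e2; ring.
  move/eqP; rewrite mulf_eq0 subr_eq0 (negbTE det) orbF => /eqP Z0; split=> //.
  by move/esym/eqP: e1; rewrite Z0 mul0r mulf_eq0 (negbTE d10) orbF => /eqP.
(* For two indices of the same block, a third index from the other block puts the same mixed value
   on both sides. *)
have sym01 : Z o0 o1 = Z o1 o0.
  by apply: (mulIf d10); exact: (step o0 o1 o2).
have sym23 : Z o2 o3 = Z o3 o2.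
  by apply: (mulIf d20); exact: (step o2 o3 o0).
have [z02 z20] : Z o0 o2 = 0 /\ Z o2 o0 = 0 by exact: (mixed _ _ o1 o3).
have [z03 z30] : Z o0 o3 = 0 /\ Z o3 o0 = 0 by exact: (mixed _ _ o1 o2).
have [z12 z21] : Z o1 o2 = 0 /\ Z o2 o1 = 0 by exact: (mixed _ _ o0 o3).
have [z13 z31] : Z o1 o3 = 0 /\ Z o3 o1 = 0 by exact: (mixed _ _ o0 o2).
exists (Z o0 o0), (Z o0 o1), (Z o1 o1), (Z o2 o2), (Z o2 o3), (Z o3 o3).
apply/matrixP => i j; rewrite mxE.
by case: (ord4P i) => ->; case: (ord4P j) => -> /=.
Qed.

End TwoBlocks.

(** A product [G i k * G j l] of diagonal entries is nonzero only for i = k and j = l, so the value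
    [X] may be read off either index pair. This exchanges the two mixed values. *)
Lemma swap_pairs_block_product (R : realType) (G : 'M[R]_4) x11 x12 x21 x22 :
  is_diag_mx G ->
  swap_pairs (block_product G (blockwise x11 x12 x21 x22))
  = sectional G (blockwise (- x11) (- x21) (- x12) (- x22)).
Proof.
move=> G_diag.
apply/funext => p; apply/funext => q; apply/funext => u; apply/funext => v.
have G_sym i j : G i j = G j i.
  case: (eqVneq i j) => [->//|ij].
  by rewrite !(is_diag_mxP G_diag) // eq_sym.
have GX (X : 'I_4 -> 'I_4 -> R) i j k l : X i j * (G i k * G j l) = X k l * (G i k * G j l).
  case: (eqVneq i k) => [->|ik]; last by rewrite (is_diag_mxP G_diag) // mul0r !mulr0.
  case: (eqVneq j l) => [->//|jl].
  by rewrite [G j l](is_diag_mxP G_diag) // !mulr0.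
rewrite /swap_pairs /block_product /sectional.
set X := blockwise x11 _ _ _.
transitivity (X q p * (G u q * G v p) - X q p * (G v q * G u p)).
  by rewrite -(GX X u v q p) -(GX X v u q p) !mulrA.
rewrite (G_sym p u) (G_sym q v) (G_sym p v) (G_sym q u) /X /blockwise.
case: (p < 2)%N; case: (q < 2)%N; ring.
Qed.

(** * Partial derivatives *)

Section PointwiseDerivatives.
Context {R : realType} {V : normedModType R}.
Implicit Types (F G : V -> R) (x v : V) (a b : R).

Lemma is_derive_add F G x v a b : is_derive x v F a -> is_derive x v G b ->
  is_derive x v (fun y => F y + G y) (a + b).
Proof. by move=> dF dG; exact: (is_deriveD dF dG). Qed.

Lemma is_derive_opp F x v a : is_derive x v F a ->
  is_derive x v (fun y => - F y) (- a).
Proof. by move=> dF; exact: (is_deriveN dF). Qed.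

Lemma is_derive_mul F G x v a b : is_derive x v F a -> is_derive x v G b ->
  is_derive x v (fun y => F y * G y) (a * G x + F x * b).
Proof.
move=> dF dG; apply: (is_derive_eq (is_deriveM dF dG)).
by rewrite addrC [a * _]mulrC.
Qed.

Lemma is_derive_const x v a : is_derive x v (fun=> a) 0.
Proof. exact: is_derive_cst. Qed.

Lemma is_derive_eq_fun F G x v a : (forall y, F y = G y) ->
  is_derive x v F a -> is_derive x v G a.
Proof. by move=> /funext <-. Qed.

End PointwiseDerivatives.

Lemma is_derive_inv (R : realType) (F : R -> R) (r a : R) :
  F r != 0 -> is_derive r 1 F a ->
  is_derive r 1 (fun y => (F y)^-1) (- a / F r ^+ 2).
Proof.
move=> F0 dF; apply: (is_derive_eq (is_deriveV F0 dF)).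
by rewrite -[_ *: _]/(_ * _); field.
Qed.

Lemma is_derive_sqr (R : realType) (F : R -> R) (r a : R) :
  is_derive r 1 F a ->
  is_derive r 1 (fun y => F y ^+ 2) (2 * F r * a).
Proof.
move=> dF; apply: (is_derive_eq_fun (F := fun y => F y * F y)) => [y|].
  by rewrite expr2.
by apply: (is_derive_eq (is_derive_mul dF dF)); ring.
Qed.

Section Separable.
Context {R : realType} {n : nat}.

Lemma is_derive_coord (u : R -> R) (i j : 'I_n) (x : 'rV[R]_n) (a : R) :
  is_derive (x ord0 j) 1 u a ->
  is_derive x (delta_mx ord0 i : 'rV[R]_n) (fun y => u (y ord0 j))
    ((i == j)%:R * a).
Proof.
move=> [du ua].
have dc : differentiable (fun y : 'rV[R]_n => y ord0 j : R) x.
  exact: differentiable_coord.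
have du' : differentiable u (x ord0 j) by apply/derivable1_diffP.
have dlin : 'd (fun y : 'rV[R]_n => y ord0 j : R) x (delta_mx ord0 i : 'rV[R]_n) = (i == j)%:R.
  have @f : {linear 'rV[R]_n -> R}.
    by exists (fun N : 'rV[R]_n => N ord0 j); do 2![eexists]; do ?[constructor];
       rewrite ?mxE// => ? *; rewrite ?mxE//; move=> ?; rewrite !mxE.
  rewrite (_ : (fun _ => _) = f) // diff_lin; last exact/coord_continuous.
  by rewrite /f /= mxE eqxx eq_sym.
apply: (@DeriveDef _ _ _ _ _ (u \o (fun y : 'rV[R]_n => y ord0 j))).
  exact/diff_derivable/differentiable_comp.
rewrite deriveE; last exact: differentiable_comp.
rewrite diff_comp //= dlin -[(i == j)%:R]mulr1 linearZ /=.
by rewrite -deriveE // ua [_ *: _]/(_ * _) mulr1.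
Qed.

(** Every entry of a static metric and every one of its Christoffel symbols is a function of r times
    a function of theta. *)
Lemma is_derive_separable (u v : R -> R) (i j k : 'I_n) (x : 'rV[R]_n)
    (a b : R) :
  is_derive (x ord0 j) 1 u a -> is_derive (x ord0 k) 1 v b ->
  is_derive x (delta_mx ord0 i : 'rV[R]_n)
    (fun y => u (y ord0 j) * v (y ord0 k))
    ((i == j)%:R * a * v (x ord0 k) + u (x ord0 j) * ((i == k)%:R * b)).
Proof. by move=> du dv; apply: is_derive_mul; exact: is_derive_coord. Qed.

Lemma partialE (F : 'rV[R]_n -> R) (i : 'I_n) (x : 'rV[R]_n) a :
  is_derive x (delta_mx ord0 i : 'rV[R]_n) F a -> partial i F x = a.
Proof. by case. Qed.

Lemma near_eq_partial (F G : 'rV[R]_n -> R) (i : 'I_n) (x : 'rV[R]_n) :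
  (\near x, F x = G x) -> partial i F x = partial i G x.
Proof. exact: near_eq_derive. Qed.

End Separable.

(** Differentiability is local: the first-order expansion of [F] at [x] is also one of [G]. It
    serves for iterated partial derivatives whose closed form holds on an open set only. *)
Lemma near_eq_differentiable (R : realType) (V W : normedModType R)
    (F G : V -> W) (x : V) :
  (\near x, F x = G x) -> differentiable F x -> differentiable G x.
Proof.
move=> FG dF; have [cF eF] := (diff_locallyP _ _).1 dF.
have eG : G \o shift x = cst (G x) + 'd F x +o_ (0 : V) id.
  apply/eqaddoP => e e0; have /eqaddoP/(_ e e0) := eF.
  move: FG; rewrite (near_shift 0) /= subr0 => FG h.
  near=> y; rewrite -[leLHS](_ : `|(F \o shift x - (cst (F x) + 'd F x)) y| = _).
    by near: y.
  congr `|_|; rewrite /= !fctE /=.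
  have -> : F x = G x.
    by have := nbhs_singleton FG; rewrite /= add0r.
  by congr (_ - _); near: y; exact: FG.
by apply/diff_locallyP; rewrite (diff_unique cF eG).
Unshelve. all: by end_near. Qed.

(** * Rational functions of one coordinate, and continuity across roots *)

Section RationalFunctions.
Context {R : realType} {n : nat}.
Implicit Types (p q : {poly R}) (j : 'I_n) (U : set 'rV[R]_n).

Lemma is_derive_ratio p q (r : R) : q.[r] != 0 ->
  is_derive r 1 (fun r => p.[r] / q.[r])
    ((p^`() * q - p * q^`()).[r] / (q ^+ 2).[r]).
Proof.
move=> q0.
apply: (is_derive_eq (is_derive_mul (is_derive_poly p r)
  (is_derive_inv q0 (is_derive_poly q r)))).
by rewrite hornerD hornerN !hornerM; field.
Qed.

Lemma differentiable_ratio p q j (x : 'rV[R]_n) : q.[x ord0 j] != 0 ->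
  differentiable (fun x : 'rV[R]_n => p.[x ord0 j] / q.[x ord0 j]) x.
Proof.
move=> q0; have [d _] := is_derive_ratio p q0.
apply: (@differentiable_comp _ _ _ _ (fun x : 'rV[R]_n => x ord0 j)
  (fun r => p.[r] / q.[r])); first exact: differentiable_coord.
exact/derivable1_diffP.
Qed.

Lemma smooth_on_ratio U p q j : open U -> (forall x, U x -> q.[x ord0 j] != 0) ->
  smooth_on U (fun x => p.[x ord0 j] / q.[x ord0 j]).
Proof.
move=> oU q0 s.
(* The induction is on a stronger claim: each iterated partial derivative agrees on [U] with another
   ratio whose denominator has no zero there. For i distinct from j the factor [(i == j)%:R] makes
   the numerator 0. *)
suff [p' [q' [q'0 E]]] : exists p' q', (forall x, U x -> q'.[x ord0 j] != 0) /\
    forall x, U x -> foldr partial (fun x => p.[x ord0 j] / q.[x ord0 j]) s x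
      = p'.[x ord0 j] / q'.[x ord0 j].
  move=> x Ux; apply: (near_eq_differentiable _ (differentiable_ratio p' (q'0 x Ux))).
  by near=> y; rewrite E //; near: y; exact: open_nbhs_nbhs.
elim: s => [|i s [p' [q' [q'0 E]]]]; first by exists p, q.
exists ((i == j)%:R *: (p'^`() * q' - p' * q'^`())), (q' ^+ 2); split=> x Ux.
  by rewrite horner_exp expf_neq0 ?q'0.
rewrite /= (@near_eq_partial _ _ _ (fun x => p'.[x ord0 j] / q'.[x ord0 j])); last first.
  by near=> y; rewrite E //; near: y; exact: open_nbhs_nbhs.
rewrite (partialE (is_derive_coord i (is_derive_ratio p' (q'0 x Ux)))).
by rewrite [in RHS]hornerZ mulrA.
Unshelve. all: by end_near. Qed.

End RationalFunctions.

(** After the full power of X - r is split off, the cofactor is nonzero at r and so, by continuity,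
    near r. *)
Lemma dnbhs_horner_neq0 (R : realType) (p : {poly R}) (r : R) :
  p != 0 -> \forall t \near r^', p.[t] != 0.
Proof.
move=> p0; have [k [q]] := multiplicity_XsubC p r; rewrite p0 /= => qr ->.
have cq : \forall t \near r, q.[t] != 0.
  have := @continuous_horner _ q r => /cvgr_neq0; apply.
  exact: qr.
near=> t; rewrite hornerM horner_exp hornerXsubC mulf_neq0 //.
  by near: t; exact: nbhs_dnbhs.
rewrite expf_neq0 // subr_eq0; near: t; exact: nbhs_dnbhs_neq.
Unshelve. all: by end_near. Qed.

(* A line in the direction of the j-th coordinate meets the zero set of p in
   isolated points only. *)
Lemma continuous_eq0_off_roots (R : realType) (n : nat) (U : set 'rV[R]_n) (j : 'I_n)
    (p : {poly R}) (h : 'rV[R]_n -> R) (x : 'rV[R]_n) :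
  open U -> U x -> p != 0 -> {for x, continuous h} ->
  (forall y, U y -> p.[y ord0 j] != 0 -> h y = 0) -> h x = 0.
Proof.
move=> oU Ux p0 ch h0; apply: contrapT => /eqP hx.
have near_x : \forall y \near x, U y /\ h y != 0.
  by apply: filterI; [exact: open_nbhs_nbhs|exact: (cvgr_neq0 _ ch)].
pose r := x ord0 j.
pose line (t : R) : 'rV[R]_n := x + (t - r) *: delta_mx ord0 j.
have cl : line @ r --> x.
  rewrite -[X in _ --> X]addr0 -(scale0r (delta_mx ord0 j)) -(subrr r).
  apply: cvgD; first exact: cvg_cst.
  apply: cvgZr_tmp; apply: cvgB; [exact: cvg_id|exact: cvg_cst].
have near_r : \forall t \near r^', (U (line t) /\ h (line t) != 0) /\ p.[t] != 0.
  apply: filterI; last exact: dnbhs_horner_neq0.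
  have near_l : \forall t \near r, U (line t) /\ h (line t) != 0.
    exact: cl near_x.
  exact: nbhs_dnbhs near_l.
near r^' => t.
have [[Ut ht] pt] : (U (line t) /\ h (line t) != 0) /\ p.[t] != 0 by near: t.
have lineE : line t ord0 j = t by rewrite /line !mxE !eqxx mulr1 addrC subrK.
by move/eqP: ht; apply; apply: h0 => //; rewrite lineE.
Unshelve. all: by end_near. Qed.

(** * Covariant derivatives *)

Definition covariant2 (R : realType) (n : nat) (g A : 'rV[R]_n -> 'M[R]_n)
    (x : 'rV[R]_n) (s p q : 'I_n) : R :=
  partial s (fun y => A y p q) x
  - \sum_l (christoffel g l s p x * A x l q + christoffel g l s q x * A x p l).

Lemma derivable_kulkarni_nomizu (R : realType) (n : nat)
    (A B : 'rV[R]_n -> 'M[R]_n) x e (p q u v : 'I_n) :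
  (forall i j, derivable (fun y => A y i j) x e) ->
  (forall i j, derivable (fun y => B y i j) x e) ->
  derivable (fun y => kulkarni_nomizu (A y) (B y) p q u v) x e.
Proof.
move=> dA dB.
have dM i j k l := is_derive_mul (derivableP (dA i j)) (derivableP (dB k l)).
by have [] := is_derive_add (is_derive_add (is_derive_add (dM p v q u)
  (is_derive_opp (dM p u q v))) (dM q u p v)) (is_derive_opp (dM q v p u)).
Qed.

(** The Leibniz rule. It reduces the covariant derivative of C to those of (0,2)-tensors that are
    block multiples of the metric. *)
Lemma covariant4_kulkarni_nomizu (R : realType) (n : nat)
    (g A B : 'rV[R]_n -> 'M[R]_n) x (s p q u v : 'I_n) :
  (forall i j, derivable (fun y => A y i j) x (delta_mx ord0 s : 'rV[R]_n)) ->
  (forall i j, derivable (fun y => B y i j) x (delta_mx ord0 s : 'rV[R]_n)) ->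
  let DA := covariant2 g A x s in
  let DB := covariant2 g B x s in
  covariant4 g (fun y => kulkarni_nomizu (A y) (B y)) x s p q u v
  = (DA p v * B x q u + A x p v * DB q u) - (DA p u * B x q v + A x p u * DB q v)
    + (DA q u * B x p v + A x q u * DB p v) - (DA q v * B x p u + A x q v * DB p u).
Proof.
move=> dA dB DA DB.
have dM i j k l := is_derive_mul (derivableP (dA i j)) (derivableP (dB k l)).
rewrite /covariant4 /kulkarni_nomizu.
rewrite (partialE (is_derive_add (is_derive_add (is_derive_add (dM p v q u)
  (is_derive_opp (dM p u q v))) (dM q u p v)) (is_derive_opp (dM q v p u)))).
rewrite /DA /DB /covariant2 /partial.
pose Ga (M : 'M[R]_n) i j :=
  \sum_l (christoffel g l s i x * M l j + christoffel g l s j x * M i l).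
set X := \sum_l _.
have -> : X = (Ga (A x) p v * B x q u + A x p v * Ga (B x) q u)
    - (Ga (A x) p u * B x q v + A x p u * Ga (B x) q v)
    + (Ga (A x) q u * B x p v + A x q u * Ga (B x) p v)
    - (Ga (A x) q v * B x p u + A x q v * Ga (B x) p u).
  rewrite /Ga !big_distrl !big_distrr /= -!big_split -!sumrB -big_split -sumrB /=.
  by apply: eq_bigr => l _; ring.
rewrite -!/(Ga _ _ _); ring.
Qed.

Lemma covariant4D (R : realType) (n : nat) (g : 'rV[R]_n -> 'M[R]_n)
    (T T' : 'rV[R]_n -> tensor4 R n) x (s p q u v : 'I_n) :
  derivable (fun y => T y p q u v) x (delta_mx ord0 s : 'rV[R]_n) ->
  derivable (fun y => T' y p q u v) x (delta_mx ord0 s : 'rV[R]_n) ->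
  covariant4 g (fun y p q u v => T y p q u v + T' y p q u v) x s p q u v
  = covariant4 g T x s p q u v + covariant4 g T' x s p q u v.
Proof.
move=> dT dT'; rewrite /covariant4.
rewrite (partialE (is_derive_add (derivableP dT) (derivableP dT'))) /partial.
rewrite addrACA -opprD -big_split; congr (_ + _ - _).
by apply: eq_bigr => l _ /=; ring.
Qed.

Lemma near_eq_covariant4 (R : realType) (n : nat) (g : 'rV[R]_n -> 'M[R]_n)
    (T T' : 'rV[R]_n -> tensor4 R n) x (s p q u v : 'I_n) :
  (\near x, T x = T' x) ->
  covariant4 g T x s p q u v = covariant4 g T' x s p q u v.
Proof.
move=> TT'; rewrite /covariant4 (nbhs_singleton TT'); congr (_ - _).
by apply: near_eq_partial; apply: filterS TT' => y ->.
Qed.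

(** * Recurrence of curvature 2-forms in components *)

Section Recurrence.
Variables (R : realType) (n : nat).
Implicit Types (T : tensor4 R n) (D : 'I_n -> tensor4 R n).

Lemma eval5_rot D X1 X2 X3 X4 X5 :
  eval5 D X2 X3 X1 X4 X5 = eval5 (fun s p q => D p q s) X1 X2 X3 X4 X5.
Proof.
rewrite /eval5 /eval4.
under eq_bigr do rewrite big_distrr /=.
under [RHS]eq_bigr do rewrite big_distrr /=.
under eq_bigr do under eq_bigr do rewrite big_distrr /=.
rewrite [LHS](eq_bigr _ (fun i _ => exchange_big _ _ _ _ _ _)) /= exchange_big.
apply: eq_bigr => s _; rewrite /=; apply: eq_bigr => p _.
rewrite big_distrr; apply: eq_bigr => q _ /=.
rewrite !big_distrr; apply: eq_bigr => u _ /=.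
by rewrite !big_distrr; apply: eq_bigr => v _ /=; ring.
Qed.

Lemma eval1_mul_eval4 (w X1 X2 X3 X4 X5 : 'rV[R]_n) T :
  eval1 w X1 * eval4 T X2 X3 X4 X5
  = eval5 (fun s p q u v => w ord0 s * T p q u v) X1 X2 X3 X4 X5.
Proof.
rewrite /eval1 /eval5 big_distrl; apply: eq_bigr => s _ /=.
rewrite /eval4 !big_distrr; apply: eq_bigr => p _ /=.
rewrite !big_distrr; apply: eq_bigr => q _ /=.
rewrite !big_distrr; apply: eq_bigr => u _ /=.
by rewrite !big_distrr; apply: eq_bigr => v _ /=; ring.
Qed.

Lemma eval5D D D' X1 X2 X3 X4 X5 :
  eval5 D X1 X2 X3 X4 X5 + eval5 D' X1 X2 X3 X4 X5
  = eval5 (fun s p q u v => D s p q u v + D' s p q u v) X1 X2 X3 X4 X5.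
Proof.
by rewrite /eval5 -big_split; apply: eq_bigr => s _ /=; rewrite -mulrDr eval4D.
Qed.

Lemma recurrent_2formsP (g : 'rV[R]_n -> 'M[R]_n) (T : 'rV[R]_n -> tensor4 R n)
    (w x : 'rV[R]_n) :
  (forall s p q u v,
    covariant4 g T x s p q u v + covariant4 g T x p q s u v
    + covariant4 g T x q s p u v
    = w ord0 s * T x p q u v + w ord0 p * T x q s u v + w ord0 q * T x s p u v) ->
  recurrent_2forms g T w x.
Proof.
move=> h X1 X2 X3 X4 X5; rewrite !eval1_mul_eval4.
(* The term led by X3 is rotated twice and the one led by X2 once, first on the left-hand side and
   then on the right. *)
rewrite (eval5_rot _ X2 X3 X1) 2!(eval5_rot _ X1 X2 X3).
rewrite (eval5_rot _ X2 X3 X1) 2!(eval5_rot _ X1 X2 X3) !eval5D.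
rewrite /eval5; apply: eq_bigr => s _; congr (_ * _); congr (eval4 _ _ _ _ _).
apply/funext => p; apply/funext => q; apply/funext => u; apply/funext => v.
exact: h.
Qed.

End Recurrence.

(** * Static spherically symmetric metrics *)

(** Literal ordinals, on which index comparisons compute, in place of the ring numerals in [coord_r]
    and [coord_theta]. *)
Definition ind_r : 'I_4 := Ordinal (isT : (1 < 4)%N).
Definition ind_theta : 'I_4 := Ordinal (isT : (2 < 4)%N).

Lemma coord_rE (R : realType) (x : 'rV[R]_4) : coord_r x = x ord0 ind_r.
Proof. by congr (x _ _); exact: val_inj. Qed.

Lemma coord_thetaE (R : realType) (x : 'rV[R]_4) :
  coord_theta x = x ord0 ind_theta.
Proof. by congr (x _ _); exact: val_inj. Qed.

(** The calculus is done for an arbitrary f with first and second derivatives f1 and f2; the Hayward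
    function enters only afterwards. *)
Definition static_metric (R : realType) (f : R -> R) (x : 'rV[R]_4) : 'M[R]_4 :=
  let r := coord_r x in
  diag_mx (row4 (- f r) (f r)^-1 (r ^+ 2) (r ^+ 2 * sin (coord_theta x) ^+ 2)).

Section StaticTables.
Context {R : realType}.
Variables f f1 f2 : R -> R.

(** The j-th diagonal entry of the metric is [metric_radial j r * metric_polar j theta]; the primed
    tables hold derivatives in r and in theta. Indices are natural numbers so that the tables
    compute. *)
Definition metric_radial (j : nat) (r : R) : R :=
  match j with 0 => - f r | 1 => (f r)^-1 | _ => r ^+ 2 end.
Definition metric_radial' (j : nat) (r : R) : R :=
  match j with 0 => - f1 r | 1 => - f1 r / f r ^+ 2 | _ => 2 * r end.
Definition metric_polar (j : nat) (t : R) : R :=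
  match j with 3 => sin t ^+ 2 | _ => 1 end.
Definition metric_polar' (j : nat) (t : R) : R :=
  match j with 3 => 2 * sin t * cos t | _ => 0 end.

(* Gamma^k_{ij} = christoffel_radial k i j r * christoffel_polar k i j theta *)
Definition christoffel_radial (k i j : nat) (r : R) : R :=
  match k, i, j with
  | 0, 0, 1 | 0, 1, 0 => f1 r * (2 * f r)^-1
  | 1, 0, 0 => f r * f1 r * 2^-1
  | 1, 1, 1 => - (f1 r * (2 * f r)^-1)
  | 1, 2, 2 | 1, 3, 3 => - (r * f r)
  | 2, 1, 2 | 2, 2, 1 | 3, 1, 3 | 3, 3, 1 => r^-1
  | 2, 3, 3 | 3, 2, 3 | 3, 3, 2 => 1
  | _, _, _ => 0
  end.
Definition christoffel_radial' (k i j : nat) (r : R) : R :=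
  match k, i, j with
  | 0, 0, 1 | 0, 1, 0 => (f2 r * f r - f1 r ^+ 2) / (2 * f r ^+ 2)
  | 1, 0, 0 => (f1 r ^+ 2 + f r * f2 r) * 2^-1
  | 1, 1, 1 => - ((f2 r * f r - f1 r ^+ 2) / (2 * f r ^+ 2))
  | 1, 2, 2 | 1, 3, 3 => - (f r + r * f1 r)
  | 2, 1, 2 | 2, 2, 1 | 3, 1, 3 | 3, 3, 1 => - 1 / r ^+ 2
  | _, _, _ => 0
  end.
Definition christoffel_polar (k i j : nat) (t : R) : R :=
  match k, i, j with
  | 1, 3, 3 => sin t ^+ 2
  | 2, 3, 3 => - (sin t * cos t)
  | 3, 2, 3 | 3, 3, 2 => cos t * (sin t)^-1
  | _, _, _ => 1
  end.
Definition christoffel_polar' (k i j : nat) (t : R) : R :=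
  match k, i, j with
  | 1, 3, 3 => 2 * sin t * cos t
  | 2, 3, 3 => sin t ^+ 2 - cos t ^+ 2
  | 3, 2, 3 | 3, 3, 2 => - 1 - cos t ^+ 2 / sin t ^+ 2
  | _, _, _ => 0
  end.

Variable r : R.
Hypotheses (r0 : r != 0) (fr0 : f r != 0).
Hypotheses (df : is_derive r 1 f (f1 r)) (df1 : is_derive r 1 f1 (f2 r)).

Lemma is_derive_metric_radial j :
  is_derive r 1 (metric_radial j) (metric_radial' j r).
Proof.
case: j => [|[|j]] /=.
- exact: is_derive_opp.
- exact: is_derive_inv.
- by apply: (is_derive_eq (is_derive_sqr (is_derive_id r 1))); ring.
Qed.

Lemma is_derive_christoffel_radial k i j :
  is_derive r 1 (christoffel_radial k i j) (christoffel_radial' k i j r).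
Proof.
have d0 : is_derive r 1 (fun r => f1 r * (2 * f r)^-1)
    ((f2 r * f r - f1 r ^+ 2) / (2 * f r ^+ 2)).
  have f20 : 2 * f r != 0 by rewrite mulf_neq0.
  have h := is_derive_mul df1 (is_derive_inv (F := fun r => 2 * f r) f20
    (is_derive_mul (is_derive_const r 1 2) df)).
  by apply: (is_derive_eq h); field.
have d1 : is_derive r 1 (fun r => f r * f1 r * 2^-1)
    ((f1 r ^+ 2 + f r * f2 r) * 2^-1).
  apply: (is_derive_eq (is_derive_mul (is_derive_mul df df1)
    (is_derive_const r 1 2^-1))).
  by ring.
have d2 : is_derive r 1 (fun r => - (r * f r)) (- (f r + r * f1 r)).
  by apply: (is_derive_eq (is_derive_opp (is_derive_mul (is_derive_id r 1) df)));
    rewrite mul1r.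
have d3 : is_derive r 1 (fun r => r^-1) (- 1 / r ^+ 2).
  exact: (is_derive_inv r0 (is_derive_id r 1)).
case: k => [|[|[|[|k]]]]; case: i => [|[|[|[|i]]]]; case: j => [|[|[|[|j]]]] /=;
  try exact: is_derive_const; try exact: d0; try exact: d1; try exact: d2;
  try exact: d3.
exact: (is_derive_opp d0).
Qed.

Lemma is_derive_metric_polar j (t : R) :
  is_derive t 1 (metric_polar j) (metric_polar' j t).
Proof.
case: j => [|[|[|[|j]]]] /=; try exact: is_derive_const.
exact: (is_derive_sqr (is_derive_sin t)).
Qed.

Lemma is_derive_christoffel_polar k i j (t : R) : sin t != 0 ->
  is_derive t 1 (christoffel_polar k i j) (christoffel_polar' k i j t).
Proof.
move=> t0.
have d1 : is_derive t 1 (fun t => sin t ^+ 2) (2 * sin t * cos t).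
  exact: (is_derive_sqr (is_derive_sin t)).
have d2 : is_derive t 1 (fun t => - (sin t * cos t)) (sin t ^+ 2 - cos t ^+ 2).
  apply: (is_derive_eq (is_derive_opp (is_derive_mul (is_derive_sin t)
    (is_derive_cos t)))); ring.
have d3 : is_derive t 1 (fun t => cos t * (sin t)^-1) (- 1 - cos t ^+ 2 / sin t ^+ 2).
  apply: (is_derive_eq (is_derive_mul (is_derive_cos t)
    (is_derive_inv t0 (is_derive_sin t)))).
  by field.
case: k => [|[|[|[|k]]]]; case: i => [|[|[|[|i]]]]; case: j => [|[|[|[|j]]]] /=;
  try exact: is_derive_const; try exact: d1; try exact: d2; exact: d3.
Qed.

End StaticTables.

Lemma static_metric_entry (R : realType) (f : R -> R) (x : 'rV[R]_4) i j :
  static_metric f x i j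
  = metric_radial f i (x ord0 ind_r) * metric_polar i (x ord0 ind_theta)
    *+ (i == j).
Proof.
rewrite /static_metric !mxE coord_rE coord_thetaE; congr (_ *+ _).
by case: i => [[|[|[|[|//]]]] ?] /=; rewrite ?mulr1.
Qed.

Lemma static_metric_diag (R : realType) (f : R -> R) (x : 'rV[R]_4) :
  is_diag_mx (static_metric f x).
Proof. exact: diag_mx_is_diag. Qed.

Lemma static_metric_sym (R : realType) (f : R -> R) (x : 'rV[R]_4) :
  (static_metric f x)^T = static_metric f x.
Proof. exact: tr_diag_mx. Qed.

(** * Curvature and covariant derivatives of a static metric *)

Section StaticMetric.
Context {R : realType}.
Variables (f f1 f2 : R -> R) (U : set 'rV[R]_4).
Hypothesis U_open : open U.
Hypothesis U_regular : forall x, U x ->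
  [/\ x ord0 ind_r != 0, f (x ord0 ind_r) != 0 & sin (x ord0 ind_theta) != 0].
Hypothesis df : forall x, U x -> is_derive (x ord0 ind_r) 1 f (f1 (x ord0 ind_r)).
Hypothesis df1 : forall x, U x -> is_derive (x ord0 ind_r) 1 f1 (f2 (x ord0 ind_r)).

Lemma static_metric_unit x : U x -> static_metric f x \in unitmx.
Proof.
move=> /U_regular[r0 f0 s0]; rewrite unitmxE det_diag unitfE.
apply/prodf_neq0 => i _; rewrite mxE coord_rE coord_thetaE.
by case: i => [[|[|[|[|//]]]] ?] /=;
  rewrite ?oppr_eq0 ?invr_eq0 ?mulf_neq0 ?expf_neq0.
Qed.

Lemma is_derive_static_metric x i j l : U x ->
  is_derive x (delta_mx ord0 i : 'rV[R]_4) (fun y => static_metric f y j l)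
  (((i == ind_r)%:R * metric_radial' f f1 j (x ord0 ind_r)
      * metric_polar j (x ord0 ind_theta)
    + metric_radial f j (x ord0 ind_r)
      * ((i == ind_theta)%:R * metric_polar' j (x ord0 ind_theta)))
    *+ (j == l)).
Proof.
move=> Ux; have [r0 f0 s0] := U_regular Ux.
case: (eqVneq j l) => [<-|jl]; rewrite ?mulr1n ?mulr0n.
  have h := is_derive_separable (n := 4) i (is_derive_metric_radial f0 (df Ux) j)
    (is_derive_metric_polar j (x ord0 ind_theta)).
  by apply: is_derive_eq_fun h => y; rewrite static_metric_entry eqxx.
apply: (is_derive_eq_fun _ (is_derive_const _ _ 0)) => y.
by rewrite static_metric_entry (negbTE jl).
Qed.

(** Diagonality leaves only the term l = k of the sum; the 64 index triples are then checked against
    the tables. *)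
Lemma christoffel_static_metric x k i j : U x ->
  christoffel (static_metric f) k i j x
  = christoffel_radial f f1 k i j (x ord0 ind_r)
    * christoffel_polar k i j (x ord0 ind_theta).
Proof.
move=> Ux; have [r0 f0 s0] := U_regular Ux.
rewrite /christoffel (bigD1 k) //= [X in _ + X]big1 ?addr0; last first.
  move=> l lk; rewrite invmx_diag ?static_metric_diag ?static_metric_unit //.
  by rewrite eq_sym (negbTE lk) mul0r.
rewrite invmx_diag ?static_metric_diag ?static_metric_unit // eqxx.
rewrite !(partialE (is_derive_static_metric _ _ _ Ux)) static_metric_entry eqxx !mulr1n.
move: r0 f0 s0; move: (x ord0 ind_r) (x ord0 ind_theta) => r t r0 f0 s0.
case: k => [[|[|[|[|//]]]] ?]; case: i => [[|[|[|[|//]]]] ?];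
  case: j => [[|[|[|[|//]]]] ?] /=; rewrite ?mulr1n ?mulr0n.
all: by field; rewrite ?f0 ?r0 ?s0.
Qed.

Lemma partial_christoffel_static_metric x l k i j : U x ->
  partial l (christoffel (static_metric f) k i j) x
  = (l == ind_r)%:R * christoffel_radial' f f1 f2 k i j (x ord0 ind_r)
      * christoffel_polar k i j (x ord0 ind_theta)
    + christoffel_radial f f1 k i j (x ord0 ind_r)
      * ((l == ind_theta)%:R * christoffel_polar' k i j (x ord0 ind_theta)).
Proof.
move=> Ux; have [r0 f0 s0] := U_regular Ux.
(* The closed form holds only on [U]; since [U] is open, it may be differentiated there. *)
rewrite (@near_eq_partial _ _ _ (fun y => christoffel_radial f f1 k i j (y ord0 ind_r)
  * christoffel_polar k i j (y ord0 ind_theta))); last first.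
  near=> y; apply: christoffel_static_metric.
  near: y; exact: open_nbhs_nbhs.
apply: partialE; apply: is_derive_separable.
  exact: (is_derive_christoffel_radial r0 f0 (df Ux) (df1 Ux)).
exact: is_derive_christoffel_polar.
Unshelve. all: by end_near. Qed.

(** Diagonality leaves the term l = p, and all 256 index quadruples are checked. On the (theta,
    phi)-plane the value is the Gauss equation: 1 / r^2 for the round sphere, less f / r^2 for its
    extrinsic curvature. *)
Lemma riemann_static_metric x : U x ->
  let r := x ord0 ind_r in
  riemann (static_metric f) x
  = sectional (static_metric f x)
      (blockwise (- f2 r / 2) (- f1 r / (2 * r)) (- f1 r / (2 * r))
                 ((1 - f r) / r ^+ 2)).
Proof.
move=> Ux r.
apply/funext => p; apply/funext => q; apply/funext => u; apply/funext => v.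
rewrite /riemann (bigD1 p) //= big1 ?addr0; last first.
  by move=> l lp; rewrite static_metric_entry eq_sym (negbTE lp) mul0r.
rewrite /riemann13 !partial_christoffel_static_metric // sum_ord4.
rewrite !christoffel_static_metric // /sectional !static_metric_entry.
rewrite /=.
have [] := U_regular Ux; rewrite /r {r}.
move: (x ord0 ind_r) (x ord0 ind_theta) => r t r0 f0 s0.
case: p => [[|[|[|[|//]]]] ?]; case: q => [[|[|[|[|//]]]] ?];
  case: u => [[|[|[|[|//]]]] ?]; case: v => [[|[|[|[|//]]]] ?];
  rewrite /blockwise /= ?mulr1n ?mulr0n.
all: by field; rewrite ?f0 ?r0 ?s0.
Qed.

Lemma is_derive_block_scale_static_metric (al be : R -> R) (al1 be1 : R) x
    (s i j : 'I_4) :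
  U x -> let r := x ord0 ind_r in
  is_derive r 1 al al1 -> is_derive r 1 be be1 ->
  is_derive x (delta_mx ord0 s : 'rV[R]_4)
    (fun y => block_scale (static_metric f y) (al (y ord0 ind_r))
                (be (y ord0 ind_r)) i j)
    ((s == ind_r)%:R * (if (i < 2)%N then al1 else be1) * static_metric f x i j
     + (if (i < 2)%N then al r else be r)
       * (((s == ind_r)%:R * metric_radial' f f1 i r * metric_polar i (x ord0 ind_theta)
           + metric_radial f i r * ((s == ind_theta)%:R * metric_polar' i (x ord0 ind_theta)))
          *+ (i == j))).
Proof.
move=> Ux r dal dbe; have dg := is_derive_static_metric s i j Ux.
case: (boolP (i < 2)%N) => i2.
  apply: (is_derive_eq_fun _ (is_derive_mul (is_derive_coord s dal) dg)) => y.
  by rewrite block_scaleE i2.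
apply: (is_derive_eq_fun _ (is_derive_mul (is_derive_coord s dbe) dg)) => y.
by rewrite block_scaleE (negbTE i2).
Qed.

(** With h the angular part of g, the tensor is al g + (be - al) h. As g is parallel, only the
    derivatives of the coefficients and (be - al) times the derivative of h contribute. *)
Lemma covariant2_static_metric (al be : R -> R) (al1 be1 : R) x (s p q : 'I_4) :
  U x -> let r := x ord0 ind_r in
  is_derive r 1 al al1 -> is_derive r 1 be be1 ->
  covariant2 (static_metric f) (fun y => block_scale (static_metric f y)
    (al (y ord0 ind_r)) (be (y ord0 ind_r))) x s p q
  = (s == ind_r)%:R * block_scale (static_metric f x) al1 be1 p q
    - (be r - al r) / r
      * ((p == ind_r)%:R * block_scale (static_metric f x) 0 1 s q
         + (q == ind_r)%:R * block_scale (static_metric f x) 0 1 s p).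
Proof.
move=> Ux r dal dbe; rewrite /covariant2.
rewrite (partialE (is_derive_block_scale_static_metric s p q Ux dal dbe)).
rewrite sum_ord4.
rewrite !christoffel_static_metric // !block_scaleE !static_metric_entry /=.
have [] := U_regular Ux; rewrite {dal dbe} /r {r}.
move: (al _) (be _) => al0 be0.
move: (x ord0 ind_r) (x ord0 ind_theta) => r t r0 f0 s0.
case: p => [[|[|[|[|//]]]] ?]; case: q => [[|[|[|[|//]]]] ?];
  case: s => [[|[|[|[|//]]]] ?]; rewrite /= ?mulr1n ?mulr0n.
all: by field; rewrite ?f0 ?r0 ?s0.
Qed.

Variables (psi : R -> R) (psi1 w : R) (x : 'rV[R]_4).
Hypothesis Ux : U x.
Let r := x ord0 ind_r.
Hypothesis psiE : forall y, U y -> let r := y ord0 ind_r in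
  psi r = - ((- f2 r / 2 + (1 - f r) / r ^+ 2 - 2 * (- f1 r / (2 * r))) / 6).
Hypothesis dpsi : is_derive r 1 psi psi1.
(** Up to the factor psi, this says that w is the logarithmic derivative of r^3 psi. *)
Hypothesis wE : psi r * w = psi1 + 3 * psi r / r.

(* With h the angular part of g and psi the sectional curvature of C on mixed
   planes, C = psi (g ^ g - 3 g ^ h + 3 h ^ h), grouped so that each summand is
   a product of two tensors whose covariant derivative is known. *)
Lemma conformal_static_metric y : U y ->
  conformal (static_metric f) y = fun p q u v =>
    kulkarni_nomizu
      (block_scale (static_metric f y) (psi (y ord0 ind_r)) (psi (y ord0 ind_r)))
      (block_scale (static_metric f y) 1 (-2)) p q u v
    + kulkarni_nomizu
      (block_scale (static_metric f y) 0 (3 * psi (y ord0 ind_r)))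
      (block_scale (static_metric f y) 0 1) p q u v.
Proof.
move=> Uy.
rewrite (conformalE (static_metric_unit Uy) (static_metric_sym f y)
  (riemann_static_metric Uy)).
rewrite !kulkarni_nomizu_block_scale psiE //.
apply/funext => p; apply/funext => q; apply/funext => u; apply/funext => v.
have [r0 _ _] := U_regular Uy.
rewrite /sectional /blockwise.
by case: (p < 2)%N; case: (q < 2)%N; field.
Qed.

Lemma recurrent_2forms_static_metric :
  recurrent_2forms (static_metric f) (conformal (static_metric f))
    (row4 0 w 0 0) x.
Proof.
apply: recurrent_2formsP => s p q u v.
rewrite !(@near_eq_covariant4 _ _ _ (conformal (static_metric f)) _ x _ _ _ _ _ 
  (filterS conformal_static_metric (open_nbhs_nbhs (conj U_open Ux)))).
have d3 : is_derive r 1 (fun r => 3 * psi r) (3 * psi1).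
  by apply: (is_derive_eq (is_derive_mul (is_derive_const r 1 3) dpsi)); ring.
have der al be al1 be1 (dal : is_derive r 1 al al1) (dbe : is_derive r 1 be be1) s' i j :
    derivable (fun y => block_scale (static_metric f y) (al (y ord0 ind_r))
                (be (y ord0 ind_r)) i j) x (delta_mx ord0 s' : 'rV[R]_4).
  by have [] := is_derive_block_scale_static_metric s' i j Ux dal dbe.
have dc c := is_derive_const r 1 c.
set g := static_metric f; pose G := g x.
pose rho (s : 'I_4) : R := (s == ind_r)%:R.
(* [D] is the right-hand side of [covariant2_static_metric], and [K] that of the Leibniz rule
   [covariant4_kulkarni_nomizu]. *)
pose D a b a1 b1 s p q := rho s * block_scale G a1 b1 p q
  - (b - a) / r * (rho p * block_scale G 0 1 s q + rho q * block_scale G 0 1 s p).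
pose K (A B : 'M[R]_4) (DA DB : 'I_4 -> 'I_4 -> R) (p q u v : 'I_4) :=
  (DA p v * B q u + A p v * DB q u) - (DA p u * B q v + A p u * DB q v)
    + (DA q u * B p v + A q u * DB p v) - (DA q v * B p u + A q v * DB p u).
pose a0 := psi r.
set T := fun y : 'rV[R]_4 => _.
have covE s' p' q' : covariant4 g T x s' p' q' u v
  = K (block_scale G a0 a0) (block_scale G 1 (-2))
      (D a0 a0 psi1 psi1 s') (D 1 (-2) 0 0 s') p' q' u v
    + K (block_scale G 0 (3 * a0)) (block_scale G 0 1)
      (D 0 (3 * a0) 0 (3 * psi1) s') (D 0 1 0 0 s') p' q' u v.
  have d1 := der _ _ _ _ dpsi dpsi s'.
  have d2 := der _ _ _ _ (dc 1) (dc (-2)) s'.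
  have d4 := der _ _ _ _ (dc 0) d3 s'.
  have d5 := der _ _ _ _ (dc 0) (dc 1) s'.
  rewrite /T covariant4D; last 2 first.
  - exact: (derivable_kulkarni_nomizu d1 d2).
  - exact: (derivable_kulkarni_nomizu d4 d5).
  rewrite (covariant4_kulkarni_nomizu _ _ _ _ _ d1 d2).
  rewrite (covariant4_kulkarni_nomizu _ _ _ _ _ d4 d5).
  rewrite !(covariant2_static_metric _ _ _ Ux dpsi dpsi).
  rewrite !(covariant2_static_metric _ _ _ Ux (dc 1) (dc (-2))).
  rewrite !(covariant2_static_metric _ _ _ Ux (dc 0) d3).
  by rewrite !(covariant2_static_metric _ _ _ Ux (dc 0) (dc 1)).
rewrite !covE (conformal_static_metric Ux) -/r -/a0 -/g -/G /kulkarni_nomizu {covE}.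
have wrho i : row4 0 w 0 0 ord0 i = rho i * w.
  rewrite mxE /rho; case: i => [[|[|[|[|//]]]] ?] /=; rewrite ?mul0r ?mul1r //.
(* Eliminating psi1, with the inverse of r as an unknown, turns the claim into a polynomial
   identity. *)
have psi1E : psi1 = a0 * w - 3 * a0 * r^-1 by rewrite wE /a0; ring.
have G_sym i j : G i j = G j i.
  by have /matrixP/(_ j i) := static_metric_sym f x; rewrite [LHS]mxE.
rewrite !wrho psi1E /K /D !block_scaleE.
rewrite (G_sym p s) (G_sym q s) (G_sym q p) /rho.
have G0 i j : i != j -> G i j = 0 by apply/is_diag_mxP/static_metric_diag.
(* If two of s, p, q coincide, both cyclic sums vanish by skewness in the first two tensor slots.
   Otherwise the metric entries among s, p, q are 0, and only those with u or v remain. *)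
case: (eqVneq s p) => [->|sp].
  by case: (eqVneq p q) => [->|/G0 ->]; ring.
case: (eqVneq p q) => [<-|pq]; first by rewrite (G0 s p) //; ring.
case: (eqVneq q s) => [->|qs].
  by rewrite (G0 s p) // (G0 p s) 1?eq_sym //; ring.
rewrite (G0 s p) // (G0 s q) 1?eq_sym // (G0 p q) //.
move: (r^-1) (G s u) (G s v) (G p u) (G p v) (G q u) (G q v).
move=> ri Gsu Gsv Gpu Gpv Gqu Gqv.
move: sp pq qs; clear.
case: s => [[|[|[|[|//]]]] ?]; case: p => [[|[|[|[|//]]]] ?] //;
  case: q => [[|[|[|[|//]]]] ?] // _ _ _; rewrite /=; ring.
Qed.

End StaticMetric.

(** * The Hayward metric *)

Section Hayward.
Context {R : realType}.
Variables m b : R.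
Implicit Types (r : R) (x : 'rV[R]_4).

Let M := hayward_domain m b.

Definition hay_lapse r := hayB m b r / hayB1 m b r.
Definition hay_lapse' r := - (2 * m * r * hayB2 m b r / hayB1 m b r ^+ 2).
Definition hay_lapse'' r :=
  - (4 * m * (r ^+ 6 - 14 * b ^+ 2 * m * r ^+ 3 + 4 * b ^+ 4 * m ^+ 2)
     / hayB1 m b r ^+ 3).

(* Sectional curvatures of the (t, r)-plane, of the mixed planes and of the
   (theta, phi)-plane. *)
Definition hay_radial r :=
  2 * m * (r ^+ 6 - 14 * b ^+ 2 * m * r ^+ 3 + 4 * b ^+ 4 * m ^+ 2)
  / hayB1 m b r ^+ 3.
Definition hay_mixed r := m * hayB2 m b r / hayB1 m b r ^+ 2.
Definition hay_sphere r := 2 * m / hayB1 m b r.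

Lemma hayward_static : hayward m b = static_metric hay_lapse.
Proof.
apply/funext => x; rewrite /hayward /static_metric /hay_lapse.
by rewrite invf_div.
Qed.

Lemma is_derive_cube r : is_derive r 1 (fun r => r ^+ 3) (3 * r ^+ 2).
Proof.
apply: (is_derive_eq_fun (F := fun r => r ^+ 2 * r)) => [y|].
  by rewrite [RHS]exprSr.
have h := is_derive_mul (is_derive_sqr (is_derive_id r 1)) (is_derive_id r 1).
by apply: (is_derive_eq h); ring.
Qed.

Lemma is_derive_hayB r :
  is_derive r 1 (hayB m b) (2 * r * (r - 2 * m) + r ^+ 2).
Proof.
have h := is_derive_add (is_derive_const r 1 (2 * b ^+ 2 * m))
  (is_derive_mul (is_derive_sqr (is_derive_id r 1))
    (is_derive_add (is_derive_id r 1) (is_derive_const r 1 (- (2 * m))))).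
by apply: (is_derive_eq h); rewrite addr0 mulr1 add0r; ring.
Qed.

Lemma is_derive_hayB1 r : is_derive r 1 (hayB1 m b) (3 * r ^+ 2).
Proof.
have h := is_derive_add (is_derive_const r 1 (2 * b ^+ 2 * m)) (is_derive_cube r).
by apply: (is_derive_eq h); rewrite add0r.
Qed.

Lemma is_derive_hayB2 r : is_derive r 1 (hayB2 m b) (- (3 * r ^+ 2)).
Proof.
have h := is_derive_add (is_derive_const r 1 (4 * b ^+ 2 * m))
  (is_derive_opp (is_derive_cube r)).
by apply: (is_derive_eq h); rewrite add0r.
Qed.

Lemma hayward_domainE x : M x ->
  [/\ x ord0 ind_r != 0, hayB m b (x ord0 ind_r) != 0 &
      hayB1 m b (x ord0 ind_r) != 0].
Proof. by move=> [r0 _ B0 B10]; rewrite -coord_rE; split=> //; rewrite gt_eqF. Qed.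

Lemma hayward_regular x : M x ->
  [/\ x ord0 ind_r != 0, hay_lapse (x ord0 ind_r) != 0 &
      sin (x ord0 ind_theta) != 0].
Proof.
move=> Mx; have [r0 B0 B10] := hayward_domainE Mx; split=> //.
  by apply: mulf_neq0; rewrite ?invr_eq0.
by case: Mx => _ t _ _; rewrite -coord_thetaE gt_eqF ?sin_gt0_pi.
Qed.

Lemma open_hayward_domain : open M.
Proof.
have cB : continuous (hayB m b).
  by move=> r; have [d _] := is_derive_hayB r;
    exact/differentiable_continuous/derivable1_diffP.
have cB1 : continuous (hayB1 m b).
  by move=> r; have [d _] := is_derive_hayB1 r;
    exact/differentiable_continuous/derivable1_diffP.
have cr x : coord_r y @[y --> x] --> coord_r x by exact: coord_continuous.
have ct x : coord_theta y @[y --> x] --> coord_theta x by exact: coord_continuous.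
rewrite openE => x [r0 /andP[t0 tpi] B0 B10]; rewrite /interior.
near=> y; split.
- by near: y; exact: cvgr_gt (cr x) _ r0.
- apply/andP; split; near: y; first exact: cvgr_gt (ct x) _ t0.
  exact: cvgr_lt (ct x) _ tpi.
- by near: y; apply: cvgr_neq0 B0; apply: continuous_cvg; [exact: cB|exact: cr].
- by near: y; apply: cvgr_neq0 B10; apply: continuous_cvg; [exact: cB1|exact: cr].
Unshelve. all: by end_near. Qed.

Lemma is_derive_hay_lapse r : hayB1 m b r != 0 ->
  is_derive r 1 hay_lapse (hay_lapse' r).
Proof.
move=> B10; apply: (is_derive_eq (is_derive_mul (is_derive_hayB r)
  (is_derive_inv B10 (is_derive_hayB1 r)))).
by move: B10; rewrite /hay_lapse' /hayB /hayB1 /hayB2 => B10; field.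
Qed.

Lemma is_derive_hay_lapse' r : hayB1 m b r != 0 ->
  is_derive r 1 hay_lapse' (hay_lapse'' r).
Proof.
move=> B10; have B120 : hayB1 m b r ^+ 2 != 0 by rewrite expf_neq0.
have h := is_derive_opp (is_derive_mul (is_derive_mul
  (is_derive_mul (is_derive_const r 1 (2 * m)) (is_derive_id r 1))
  (is_derive_hayB2 r))
  (is_derive_inv (F := fun r => hayB1 m b r ^+ 2) B120 (is_derive_sqr (is_derive_hayB1 r)))).
apply: (is_derive_eq h).
by move: B10; rewrite /hay_lapse'' /hayB1 /hayB2 => B10 {B120 h}; field.
Qed.

Let df x : M x -> is_derive (x ord0 ind_r) 1 hay_lapse (hay_lapse' (x ord0 ind_r)).
Proof. by case/hayward_domainE=> _ _; exact: is_derive_hay_lapse. Qed.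

Let df1 x : M x ->
  is_derive (x ord0 ind_r) 1 hay_lapse' (hay_lapse'' (x ord0 ind_r)).
Proof. by case/hayward_domainE=> _ _; exact: is_derive_hay_lapse'. Qed.

Lemma hayward_diag x : is_diag_mx (hayward m b x).
Proof. by rewrite hayward_static; exact: static_metric_diag. Qed.

Lemma hayward_sym x : (hayward m b x)^T = hayward m b x.
Proof. by rewrite hayward_static; exact: static_metric_sym. Qed.

Lemma hayward_unit x : M x -> hayward m b x \in unitmx.
Proof. by rewrite hayward_static; exact/static_metric_unit/hayward_regular. Qed.

Lemma riemann_hayward x : M x ->
  let r := x ord0 ind_r in
  riemann (hayward m b) x
  = sectional (hayward m b x) (blockwise (hay_radial r) (hay_mixed r)
                                         (hay_mixed r) (hay_sphere r)).
Proof.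
move=> Mx r; rewrite hayward_static.
rewrite (riemann_static_metric open_hayward_domain hayward_regular df df1 Mx).
rewrite -/r; have [] := hayward_domainE Mx; rewrite -/r => r0 _.
rewrite /hay_lapse /hay_lapse' /hay_lapse'' /hay_radial /hay_mixed /hay_sphere.
rewrite /hayB /hayB1 /hayB2 => B10.
by congr (sectional _ (blockwise _ _ _ _)); field; rewrite ?r0 ?B10.
Qed.

(** The common value of C and W on the mixed planes; its negative is the factor in (ii) and
    (iii). *)
Definition hay_weyl r := m * r ^+ 3 * hayB2 m b r / hayB1 m b r ^+ 3.

Lemma hay_weylE r : r != 0 -> hayB1 m b r != 0 ->
  hay_weyl r = - ((hay_radial r + hay_sphere r - 2 * hay_mixed r) / 6).
Proof.
rewrite /hay_weyl /hay_radial /hay_mixed /hay_sphere /hayB1 /hayB2 => r0 B10.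
by field; rewrite ?r0 ?B10.
Qed.

Lemma recurrent_2forms_hayward x : M x -> let r := x ord0 ind_r in
  hayB2 m b r != 0 ->
  recurrent_2forms (hayward m b) (conformal (hayward m b))
    (row4 0 (6 * b ^+ 2 * m * (8 * b ^+ 2 * m - 5 * r ^+ 3) /
       (8 * b ^+ 4 * m ^+ 2 * r + 2 * b ^+ 2 * m * r ^+ 4 - r ^+ 7)) 0 0) x.
Proof.
move=> Mx r B20; rewrite hayward_static; set w := _ / _.
have [r0 _ B10] := hayward_domainE Mx; rewrite -/r in r0 B10.
have B130 : hayB1 m b r ^+ 3 != 0 by rewrite expf_neq0.
(* Here w is the logarithmic derivative 6 / r - 3 r^2 / B2 - 9 r^2 / B1 of r^3 [hay_weyl], over the
   common denominator r B1 B2. *)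
have dpsi : is_derive r 1 hay_weyl (hay_weyl r * w - 3 * hay_weyl r / r).
  have B1c : is_derive r 1 (fun r => hayB1 m b r ^+ 3)
      (3 * hayB1 m b r ^+ 2 * (3 * r ^+ 2)).
    have h := is_derive_mul (is_derive_sqr (is_derive_hayB1 r)) (is_derive_hayB1 r).
    apply: (is_derive_eq_fun (F := fun r => hayB1 m b r ^+ 2 * hayB1 m b r)).
      by move=> y; rewrite [RHS]exprSr.
    by apply: (is_derive_eq h); ring.
  have h := is_derive_mul (is_derive_mul (is_derive_mul (is_derive_const r 1 m)
    (is_derive_cube r)) (is_derive_hayB2 r))
    (is_derive_inv (F := fun r => hayB1 m b r ^+ 3) B130 B1c).
  apply: (is_derive_eq h).
  rewrite /w (_ : 8 * b ^+ 4 * m ^+ 2 * r + _ - _ = r * hayB1 m b r * hayB2 m b r);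
    last by rewrite /hayB1 /hayB2; ring.
  move: B10 B20; rewrite /hay_weyl /hayB1 /hayB2 => B10 B20 {h B1c B130}.
  by field; rewrite ?r0 ?B10 ?B20.
apply: (recurrent_2forms_static_metric open_hayward_domain hayward_regular df df1
  Mx _ dpsi); last by rewrite -/r; ring.
move=> y My; have [ry0 _ B1y0] := hayward_domainE My; move=> /=.
move: B1y0; rewrite /hay_weyl /hay_lapse /hay_lapse' /hay_lapse'' /hayB /hayB1 /hayB2.
by move=> B1y0; field; rewrite ?ry0 ?B1y0.
Qed.

End Hayward.

(** The roots of [p] include every admissible radius at which the pointwise argument may fail; the
    value at 0 certifies that [p] is not the zero polynomial. *)
Lemma compatible_iff_block_sectional (R : realType) (m b : R)
    (T : 'rV[R]_4 -> tensor4 R 4) (a d1 d2 e : R -> R) (p : {poly R}) :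
  (forall x, hayward_domain m b x -> let r := x ord0 ind_r in
    T x = sectional (hayward m b x) (blockwise (a r) (d1 r) (d2 r) (e r))) ->
  p.[0] != 0 ->
  (forall r, r != 0 -> hayB1 m b r != 0 -> p.[r] != 0 ->
    [/\ d1 r != 0, d2 r != 0 & d1 r * d2 r != a r * e r]) ->
  compatible_iff_block m b T.
Proof.
move=> TE p0 generic Z smoothZ; split=> [compat x Mx|block x Mx]; last first.
  rewrite TE //; apply: compatible_block (block x Mx).
    exact: hayward_diag.
  exact: hayward_unit.
have pN0 : p != 0 by apply: contraNneq p0 => ->; rewrite horner0.
have cZ i j : {for x, continuous (fun x => Z x i j)}.
  exact: differentiable_continuous (smoothZ i j [::] x Mx).
have off_roots y : hayward_domain m b y -> p.[y ord0 ind_r] != 0 -> block_form (Z y).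
  move=> My py; have [r0 _ B10] := hayward_domainE My.
  have [d10 d20 det] := generic _ r0 B10 py.
  have := compat y My; rewrite TE //.
  exact: (block_compatible (hayward_diag m b y) (hayward_unit My) d10 d20 det).
(* The block form amounts to equations between continuous functions, each of which extends across
   the roots of [p]. *)
apply/block_formP; split=> i j => [|ij].
  apply/eqP; rewrite -subr_eq0; apply/eqP.
  apply: (continuous_eq0_off_roots (j := ind_r) (h := fun y => Z y i j - Z y j i)
    (@open_hayward_domain _ m b) Mx pN0).
    exact: continuousB (cZ i j) (cZ j i).
  by move=> y My /(off_roots y My)/block_formP[-> _]; rewrite subrr.
apply: (continuous_eq0_off_roots (@open_hayward_domain _ m b) Mx pN0 (cZ i j)).
by move=> y My /(off_roots y My)/block_formP[_ ->].
Qed.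

(** * Algebraic curvature identities of the Hayward metric *)

Section HaywardAlgebra.
Context {R : realType}.
Variables (m b : R) (x : 'rV[R]_4).
Hypothesis Mx : hayward_domain m b x.
Let r := x ord0 ind_r.
Let g := hayward m b.

Let uG := hayward_unit Mx.
Let dG := hayward_diag m b x.
Let sG := hayward_sym m b x.
Let RE := riemann_hayward Mx.
Let SE := ricciE uG sG RE.
Let CE := conformalE uG sG RE.
Let WE := concircularE uG sG RE.
Let KE := conharmonicE uG sG RE.
Let PE := projectiveE uG sG RE.

Lemma pseudosymmetric_family T a d e L :
  T = sectional (g x) (blockwise a d d e) -> L = - d ->
  pseudosymmetric4 (g x) T (riemann g x) L /\
  pseudosymmetric2 (g x) T (ricci g x) L /\
  pseudosymmetric4 (g x) T (conformal g x) L /\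
  pseudosymmetric4 (g x) T (projective g x) L /\
  pseudosymmetric4 (g x) T (concircular g x) L /\
  pseudosymmetric4 (g x) T (conharmonic g x) L.
Proof.
move=> -> ->; rewrite SE PE CE WE KE RE.
have ps a' d' e' := @pseudosymmetric4_sectional _ _ dG uG a d e
  (- a') (- d') (- d') (- e').
split; first by rewrite [X in pseudosymmetric4 _ _ X]sectional_block_product; exact: ps.
split; first exact: pseudosymmetric2_sectional.
split; first by rewrite [X in pseudosymmetric4 _ _ X]sectional_block_product; exact: ps.
split; first exact: pseudosymmetric4_sectional.
by split; rewrite [X in pseudosymmetric4 _ _ X]sectional_block_product; exact: ps.
Qed.

Let r0 : r != 0. Proof. by case: (hayward_domainE Mx). Qed.
Let B0 : hayB m b r != 0. Proof. by case: (hayward_domainE Mx). Qed.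
Let B10 : hayB1 m b r != 0. Proof. by case: (hayward_domainE Mx). Qed.

Definition hay_ricci_radial (r : R) :=
  - (24 * b ^+ 2 * m ^+ 2 * hayB3 m b r / hayB1 m b r ^+ 3).
Definition hay_ricci_sphere (r : R) :=
  - (12 * b ^+ 2 * m ^+ 2 / hayB1 m b r ^+ 2).

Lemma ricci_hayward :
  ricci g x = block_scale (g x) (hay_ricci_radial r) (hay_ricci_sphere r).
Proof.
rewrite SE -/r; move: B10; rewrite /hay_radial /hay_mixed /hay_sphere.
rewrite /hay_ricci_radial /hay_ricci_sphere /hayB1 /hayB2 /hayB3 => B1N.
by congr block_scale; field.
Qed.

Lemma pseudosymmetric_riemann :
  let L := - (m * hayB2 m b r / hayB1 m b r ^+ 2) in
  pseudosymmetric4 (g x) (riemann g x) (riemann g x) L.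
Proof. by have [] := pseudosymmetric_family RE (erefl (- hay_mixed m b r)). Qed.

Lemma tachibana_relation q1 q2 q3 q4 nu mu : hayB2 m b r != 0 ->
  dot4 (g x) (riemann g x) (riemann g x) q1 q2 q3 q4 nu mu
  - m * (16 * b ^+ 2 * m - r ^+ 3) / (hayB2 m b r * hayB1 m b r)
    * tachibana4 (g x) (conformal g x) q1 q2 q3 q4 nu mu
  = tachibana4 (ricci g x) (riemann g x) q1 q2 q3 q4 nu mu.
Proof.
move=> B20; rewrite pseudosymmetric_riemann ricci_hayward CE RE -/r.
(* Q(g, R), Q(g, C) and Q(S, R) are all written in the two tensors of [tachibana4_block_scale],
   after which coefficients are compared. *)
have gE a d e := tachibana4_block_scale dG 1 1 a d e q1 q2 q3 q4 nu mu.
rewrite block_scale1 in gE; rewrite !gE [RHS](tachibana4_block_scale dG).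
set T1 := tachibana4 _ _ _ _ _ _ _ _; set T2 := tachibana4 _ _ _ _ _ _ _ _.
move: T1 T2 B10 B20 => T1 T2; rewrite /hay_radial /hay_mixed /hay_sphere.
rewrite /hay_ricci_radial /hay_ricci_sphere /hayB1 /hayB2 /hayB3 => B1N B2N.
by field; rewrite B1N B2N.
Qed.

(* The coefficients solve the linear system obtained by comparing the values on
   the three kinds of coordinate planes. *)
Lemma roter : b != 0 -> m != 0 ->
  let c := b ^+ 2 * m in let B1 := hayB1 m b r in
  riemann g x = fun p q u v =>
    m * (- 3 * r ^+ 3 * (r ^+ 6 - 14 * c * r ^+ 3 + 4 * c ^+ 2)
         + 2 * (c - r ^+ 3) * (r ^+ 3 + 8 * c) * (r ^+ 3 + 2 * c)
         - 4 * (4 * c - r ^+ 3) * (c - r ^+ 3) ^+ 2) / (3 * r ^+ 3 * B1 ^+ 3)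
      * kulkarni_nomizu (g x) (g x) p q u v
    + B1 * (r ^+ 3 + 8 * c) / (36 * c * r ^+ 3)
      * kulkarni_nomizu (g x) (ricci g x) p q u v
    + hayB2 m b r * B1 ^+ 3 / (432 * c ^+ 2 * m * r ^+ 3)
      * kulkarni_nomizu (ricci g x) (ricci g x) p q u v.
Proof.
move=> b0 m0 c B1; rewrite ricci_hayward.
have gE z1 z2 : kulkarni_nomizu (g x) (block_scale (g x) z1 z2)
    = kulkarni_nomizu (block_scale (g x) 1 1) (block_scale (g x) z1 z2).
  by rewrite block_scale1.
apply/funext => p; apply/funext => q; apply/funext => u; apply/funext => v.
have -> : kulkarni_nomizu (g x) (g x)
    = kulkarni_nomizu (block_scale (g x) 1 1) (block_scale (g x) 1 1).
  by rewrite block_scale1.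
rewrite gE !kulkarni_nomizu_block_scale RE -/r.
move: B10; rewrite /B1 /c /sectional /blockwise /hay_radial /hay_mixed /hay_sphere.
rewrite /hay_ricci_radial /hay_ricci_sphere /hayB1 /hayB2 /hayB3 => B1N.
by case: (p < 2)%N; case: (q < 2)%N; field; rewrite r0 B1N b0 m0.
Qed.

Lemma square2_ricci_hayward :
  square2 (g x) (ricci g x)
  + (12 * b ^+ 2 * m ^+ 2 * hayB2 m b r / hayB1 m b r ^+ 3) *: ricci g x
  + (288 * b ^+ 4 * m ^+ 4 * hayB3 m b r / hayB1 m b r ^+ 5) *: g x = 0.
Proof.
have entryE (A C D : 'M[R]_4) k l i j :
    (A + k *: C + l *: D) i j = A i j + k * C i j + l * D i j by rewrite !mxE.
rewrite ricci_hayward square2_block_scale //.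
apply/matrixP => i j; rewrite entryE !block_scaleE [RHS]mxE.
move: B10; rewrite /hay_ricci_radial /hay_ricci_sphere /hayB1 /hayB2 /hayB3 => B1N.
by case: (i < 2)%N; field.
Qed.

Let ricci_diff : hay_ricci_radial r - hay_ricci_sphere r
  = 36 * b ^+ 2 * m ^+ 2 * r ^+ 3 / hayB1 m b r ^+ 3.
Proof.
move: B10; rewrite /hay_ricci_radial /hay_ricci_sphere /hayB1 /hayB3 => B1N.
by field.
Qed.

Lemma rank_ricci_hayward : b != 0 -> m != 0 ->
  \rank (ricci g x - (- (12 * b ^+ 2 * m ^+ 2 / hayB1 m b r ^+ 2)) *: g x) = 2%N.
Proof.
move=> b0 m0; rewrite -/(hay_ricci_sphere r).
have -> : ricci g x - hay_ricci_sphere r *: g x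
    = block_scale (g x) (hay_ricci_radial r - hay_ricci_sphere r) 0.
  have entryE (A C : 'M[R]_4) k i j : (A - k *: C) i j = A i j - k * C i j.
    by rewrite !mxE.
  rewrite ricci_hayward; apply/matrixP => i j; rewrite entryE !block_scaleE.
  by case: (i < 2)%N; ring.
by rewrite rank_block_scale // ricci_diff !mulf_neq0 ?invr_eq0 ?expf_neq0.
Qed.

(** With f = B / B1, the (t, r)-part of g factors into null forms: - f dt^2 + dr^2 / f = (- f dt +
    dr)(dt + dr / f). If k is the coefficient of this part in S - alpha g, then Pi is the first
    factor and Phi + Pi / 2 is k / 2 times the second. *)
Lemma ricci_chaki : let B := hayB m b r in let B1 := hayB1 m b r in
  let Pi := row4 (- (B / B1)) 1 0 0 in
  let Phi := row4 ((36 * b ^+ 2 * m ^+ 2 * r ^+ 3 + B1 ^+ 2 * B) / (2 * B1 ^+ 3))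
                  (18 * b ^+ 2 * m ^+ 2 * r ^+ 3 / (B1 ^+ 2 * B) - 2^-1) 0 0 in
  ricci g x = (- (12 * b ^+ 2 * m ^+ 2 / B1 ^+ 2)) *: g x
    + 1 *: tensor_product Pi Pi
    + 1 *: (tensor_product Pi Phi + tensor_product Phi Pi).
Proof.
move=> B B1 Pi Phi; rewrite -/(hay_ricci_sphere r) !scale1r.
have -> : ricci g x = hay_ricci_sphere r *: g x
    + block_scale (g x) (36 * b ^+ 2 * m ^+ 2 * r ^+ 3 / B1 ^+ 3) 0.
  have entryE (A C : 'M[R]_4) k i j : (k *: A + C) i j = k * A i j + C i j.
    by rewrite !mxE.
  rewrite ricci_hayward -ricci_diff; apply/matrixP => i j.
  rewrite entryE !block_scaleE.
  by case: (i < 2)%N; ring.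
rewrite -addrA; congr (_ + _).
apply/matrixP => i j; rewrite block_scaleE !mxE !big_ord1 !mxE.
rewrite !coord_rE -/r.
move: B0 B10; rewrite -/B -/B1 => BN B1N.
by case: (ord4P i) => ->; case: (ord4P j) => -> /=; rewrite ?mulr1n ?mulr0n; field;
  rewrite ?BN ?B1N.
Qed.

(** The scalar condition of [pseudosymmetric2_block_product] holds with L = - d identically in a, d,
    e, so the factor is the one in (i). *)
Lemma projective_ricci :
  pseudosymmetric2 (g x) (projective g x) (ricci g x)
    (- (m * hayB2 m b r / hayB1 m b r ^+ 2)).
Proof.
rewrite PE SE; apply: pseudosymmetric2_block_product => //.
by rewrite -/(hay_mixed m b r); field.
Qed.

Lemma compatible_ricci :
  compatible (g x) (conformal g x) (ricci g x) /\
  compatible (g x) (swap_pairs (projective g x)) (ricci g x) /\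
  compatible (g x) (riemann g x) (ricci g x) /\
  compatible (g x) (conharmonic g x) (ricci g x) /\
  compatible (g x) (concircular g x) (ricci g x).
Proof.
have bS : block_form (ricci g x) by rewrite ricci_hayward; exact: block_form_block_scale.
rewrite CE PE KE WE RE swap_pairs_block_product //.
by split; [|split; [|split; [|split]]]; exact: compatible_block.
Qed.

End HaywardAlgebra.

(* Unlike hornerE, this leaves the association of products alone. *)
Definition horner_evalE (R : realType) :=
  (@hornerXn R, @horner_exp R, @hornerD R, @hornerN R, @hornerM R, @hornerC R).

(** * General form of the compatible tensors *)

Section CompatibleTensors.
Context {R : realType}.
Variables m b : R.
Hypotheses (hm : m != 0) (hb : b != 0).

Let c := b ^+ 2 * m.
Let g := hayward m b.
Let c0 : c != 0. Proof. by rewrite mulf_neq0 ?expf_neq0. Qed.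

Lemma compatible_iff_block_riemann : compatible_iff_block m b (riemann g).
Proof.
(* The first factor of [p] comes from d, the second from d^2 - a e. *)
apply: (compatible_iff_block_sectional (p := ((4 * c)%:P - 'X^3) * ((16 * c)%:P - 'X^3))
  (@riemann_hayward _ m b)) => [|r r0 B1N].
  by rewrite !horner_evalE !expr0n /= !subr0 !mulf_neq0.
rewrite !horner_evalE mulf_eq0 negb_or => /andP[B2N N].
have dN : hay_mixed m b r != 0.
  rewrite /hay_mixed !mulf_neq0 ?invr_eq0 ?expf_neq0 //.
  by move: B2N; rewrite /c /hayB2 mulrA.
split=> //; rewrite -subr_eq0.
rewrite (_ : _ - _ = 3 * m ^+ 2 * r ^+ 3 * (16 * c - r ^+ 3) / hayB1 m b r ^+ 4).
  by rewrite !mulf_neq0 ?invr_eq0 ?expf_neq0.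
by move: B1N; rewrite /hay_mixed /hay_radial /hay_sphere /hayB1 /hayB2 /c => B1N; field.
Qed.

Lemma compatible_iff_block_conformal : compatible_iff_block m b (conformal g).
Proof.
(* With s = a + e - 2 d formed from R, the mixed value is - s / 6 and the determinant is - s^2 / 12,
   so the single factor of s suffices. *)
apply: (compatible_iff_block_sectional (p := (4 * c)%:P - 'X^3)
  (a := fun r => (hay_radial m b r + hay_sphere m b r - 2 * hay_mixed m b r) / 3)
  (d1 := fun r => - ((hay_radial m b r + hay_sphere m b r - 2 * hay_mixed m b r) / 6))
  (d2 := fun r => - ((hay_radial m b r + hay_sphere m b r - 2 * hay_mixed m b r) / 6))
  (e := fun r => (hay_radial m b r + hay_sphere m b r - 2 * hay_mixed m b r) / 3)
  (fun x Mx => conformalE (hayward_unit Mx) (hayward_sym m b x) (riemann_hayward Mx))).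
  by rewrite !horner_evalE !expr0n /= !subr0 !mulf_neq0.
move=> r r0 B1N; rewrite !horner_evalE => N.
have E : hay_radial m b r + hay_sphere m b r - 2 * hay_mixed m b r
    = - (6 * m * r ^+ 3 * (4 * c - r ^+ 3) / hayB1 m b r ^+ 3).
  by move: B1N; rewrite /hay_mixed /hay_radial /hay_sphere /hayB1 /hayB2 /c => B1N; field.
have : hay_radial m b r + hay_sphere m b r - 2 * hay_mixed m b r != 0.
  by rewrite E oppr_eq0 !mulf_neq0 ?invr_eq0 ?expf_neq0.
cbv beta; move: (_ - 2 * _) => s sN {E}.
split; rewrite ?oppr_eq0 ?mulf_neq0 ?invr_eq0 //; rewrite -subr_eq0.
rewrite (_ : _ - _ = - (s ^+ 2 / 12)); last by field.
by rewrite oppr_eq0 mulf_neq0 ?invr_eq0 ?expf_neq0.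
Qed.

Lemma compatible_iff_block_concircular : compatible_iff_block m b (concircular g).
Proof.
(* The first factor comes from the mixed value [hay_weyl], the second from the determinant. *)
apply: (compatible_iff_block_sectional (p := ((4 * c)%:P - 'X^3)
     * (- 'X^6 + (8 * c)%:P * 'X^3 + (92 * c ^+ 2)%:P))
  (a := fun r => (5 * hay_radial m b r - 4 * hay_mixed m b r - hay_sphere m b r) / 6)
  (d1 := fun r => - ((hay_radial m b r + hay_sphere m b r - 2 * hay_mixed m b r) / 6))
  (d2 := fun r => - ((hay_radial m b r + hay_sphere m b r - 2 * hay_mixed m b r) / 6))
  (e := fun r => (5 * hay_sphere m b r - 4 * hay_mixed m b r - hay_radial m b r) / 6)
  (fun x Mx => concircularE (hayward_unit Mx) (hayward_sym m b x) (riemann_hayward Mx))).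
  by rewrite !horner_evalE !expr0n /= subr0 oppr0 mulr0 !add0r !mulf_neq0 ?expf_neq0.
move=> r r0 B1N; rewrite !horner_evalE mulf_eq0 negb_or => /andP[B2N N].
have sN : - ((hay_radial m b r + hay_sphere m b r - 2 * hay_mixed m b r) / 6) != 0.
  rewrite -hay_weylE // /hay_weyl !mulf_neq0 ?invr_eq0 ?expf_neq0 //.
  by move: B2N; rewrite /c /hayB2 mulrA.
split=> //; rewrite -subr_eq0.
rewrite (_ : _ - _ = 3 * m ^+ 2 * r ^+ 6 * (- r ^+ 6 + 8 * c * r ^+ 3 + 92 * c ^+ 2)
                     / hayB1 m b r ^+ 6).
  by rewrite !mulf_neq0 ?invr_eq0 ?expf_neq0.
by move: B1N; rewrite /hay_mixed /hay_radial /hay_sphere /hayB1 /hayB2 /c => B1N; field.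
Qed.

Lemma compatible_iff_block_conharmonic : compatible_iff_block m b (conharmonic g).
Proof.
(* The mixed value is a multiple of B2^2; the determinant contributes the further factor r^3 + 8
   c. *)
apply: (compatible_iff_block_sectional (p := ((4 * c)%:P - 'X^3) * ('X^3 + (8 * c)%:P))
  (a := fun r => - 2 * hay_mixed m b r)
  (d1 := fun r => - ((hay_radial m b r + 2 * hay_mixed m b r + hay_sphere m b r) / 2))
  (d2 := fun r => - ((hay_radial m b r + 2 * hay_mixed m b r + hay_sphere m b r) / 2))
  (e := fun r => - 2 * hay_mixed m b r)
  (fun x Mx => conharmonicE (hayward_unit Mx) (hayward_sym m b x) (riemann_hayward Mx))).
  by rewrite !horner_evalE !expr0n /= subr0 add0r !mulf_neq0.
move=> r r0 B1N; rewrite !horner_evalE mulf_eq0 negb_or => /andP[B2N N].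
have B2N' : hayB2 m b r != 0 by move: B2N; rewrite /c /hayB2 mulrA.
have E : (hay_radial m b r + 2 * hay_mixed m b r + hay_sphere m b r) / 2
    = m * hayB2 m b r ^+ 2 / hayB1 m b r ^+ 3.
  by move: B1N; rewrite /hay_mixed /hay_radial /hay_sphere /hayB1 /hayB2 => B1N; field.
have sN : - ((hay_radial m b r + 2 * hay_mixed m b r + hay_sphere m b r) / 2) != 0.
  by rewrite E oppr_eq0 !mulf_neq0 ?invr_eq0 ?expf_neq0.
split=> //; rewrite E -subr_eq0.
rewrite (_ : _ - _ = - (3 * m ^+ 2 * hayB2 m b r ^+ 2 * r ^+ 3 * (r ^+ 3 + 8 * c)
                     / hayB1 m b r ^+ 6)).
  by rewrite oppr_eq0 !mulf_neq0 ?invr_eq0 ?expf_neq0.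
by move: B1N; rewrite /hay_mixed /hayB1 /hayB2 /c => B1N; field.
Qed.

Lemma compatible_iff_block_projective :
  compatible_iff_block m b (fun x => swap_pairs (projective g x)).
Proof.
(* With s = a - d and t = e - d formed from R, the determinant is - s t / 3; t has no zero at
   admissible radii, and s contributes r^3 - 10 c. The double negations match the entries given by
   [swap_pairs_block_product]. *)
apply: (compatible_iff_block_sectional (p := 'X^3 - (10 * c)%:P)
  (a := fun r => - - (2 * (hay_radial m b r - hay_mixed m b r) / 3))
  (d1 := fun r => - ((hay_radial m b r - hay_mixed m b r) / 3))
  (d2 := fun r => - ((hay_sphere m b r - hay_mixed m b r) / 3))
  (e := fun r => - - (2 * (hay_sphere m b r - hay_mixed m b r) / 3))
  (fun x Mx =>
  etrans (congr1 (@swap_pairs R 4) (projectiveE (hayward_unit Mx) (hayward_sym m b x)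
                    (riemann_hayward Mx)))
    (swap_pairs_block_product _ _ _ _ (hayward_diag m b x)))).
  by rewrite !horner_evalE expr0n /= sub0r oppr_eq0 mulf_neq0.
move=> r r0 B1N; rewrite !horner_evalE => N.
have aE : hay_radial m b r - hay_mixed m b r
    = 3 * m * r ^+ 3 * (r ^+ 3 - 10 * c) / hayB1 m b r ^+ 3.
  by move: B1N; rewrite /hay_mixed /hay_radial /hayB1 /hayB2 /c => B1N; field.
have eE : hay_sphere m b r - hay_mixed m b r = 3 * m * r ^+ 3 / hayB1 m b r ^+ 2.
  by move: B1N; rewrite /hay_mixed /hay_sphere /hayB1 /hayB2 => B1N; field.
have aN : hay_radial m b r - hay_mixed m b r != 0.
  by rewrite aE !mulf_neq0 ?invr_eq0 ?expf_neq0.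
have eN : hay_sphere m b r - hay_mixed m b r != 0.
  by rewrite eE !mulf_neq0 ?invr_eq0 ?expf_neq0.
split; rewrite ?oppr_eq0 ?mulf_neq0 ?invr_eq0 // -subr_eq0.
set s := _ - hay_mixed _ _ _ in aN *; set t := _ - hay_mixed _ _ _ in eN *.
rewrite (_ : _ - _ = - (s * t / 3)); last by field.
by rewrite oppr_eq0 !mulf_neq0 ?invr_eq0.
Qed.

End CompatibleTensors.

Theorem theorem3p1 (R : realType) (m b : R) (hm : m != 0) (hb : b != 0) :
  let M := hayward_domain m b in
  let g := hayward m b in
  let Rm := riemann g in
  let S := ricci g in
  let C := conformal g in
  let P := projective g in
  let W := concircular g in
  let K := conharmonic g in
  let B (x : 'rV[R]_4) := hayB m b (coord_r x) in
  let B1 (x : 'rV[R]_4) := hayB1 m b (coord_r x) in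
  let B2 (x : 'rV[R]_4) := hayB2 m b (coord_r x) in
  let B3 (x : 'rV[R]_4) := hayB3 m b (coord_r x) in
  (* (i) *)
  (forall x, M x ->
    let L := - (m * B2 x / B1 x ^+ 2) in
    pseudosymmetric4 (g x) (Rm x) (Rm x) L /\
    pseudosymmetric2 (g x) (Rm x) (S x) L /\
    pseudosymmetric4 (g x) (Rm x) (C x) L /\
    pseudosymmetric4 (g x) (Rm x) (P x) L /\
    pseudosymmetric4 (g x) (Rm x) (W x) L /\
    pseudosymmetric4 (g x) (Rm x) (K x) L) /\
  (* (ii) *)
  (forall x, M x ->
    let L := - (m * coord_r x ^+ 3 * B2 x / B1 x ^+ 3) in
    pseudosymmetric4 (g x) (C x) (Rm x) L /\
    pseudosymmetric2 (g x) (C x) (S x) L /\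
    pseudosymmetric4 (g x) (C x) (C x) L /\
    pseudosymmetric4 (g x) (C x) (P x) L /\
    pseudosymmetric4 (g x) (C x) (W x) L /\
    pseudosymmetric4 (g x) (C x) (K x) L) /\
  (* (iii) *)
  (forall x, M x ->
    let L := - (m * coord_r x ^+ 3 * B2 x / B1 x ^+ 3) in
    pseudosymmetric4 (g x) (W x) (Rm x) L /\
    pseudosymmetric2 (g x) (W x) (S x) L /\
    pseudosymmetric4 (g x) (W x) (C x) L /\
    pseudosymmetric4 (g x) (W x) (P x) L /\
    pseudosymmetric4 (g x) (W x) (W x) L /\
    pseudosymmetric4 (g x) (W x) (K x) L) /\
  (* (iv) *)
  (forall x, M x ->
    let L := m * B2 x ^+ 2 / B1 x ^+ 3 in
    pseudosymmetric4 (g x) (K x) (Rm x) L /\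
    pseudosymmetric2 (g x) (K x) (S x) L /\
    pseudosymmetric4 (g x) (K x) (C x) L /\
    pseudosymmetric4 (g x) (K x) (P x) L /\
    pseudosymmetric4 (g x) (K x) (W x) L /\
    pseudosymmetric4 (g x) (K x) (K x) L) /\
  (* (v) *)
  (forall x, M x -> B2 x != 0 ->
    let L := m * (16 * b ^+ 2 * m - coord_r x ^+ 3) / (B2 x * B1 x) in
    forall q1 q2 q3 q4 nu mu,
      dot4 (g x) (Rm x) (Rm x) q1 q2 q3 q4 nu mu
      - L * tachibana4 (g x) (C x) q1 q2 q3 q4 nu mu
      = tachibana4 (S x) (Rm x) q1 q2 q3 q4 nu mu) /\
  (* (vi) *)
  (exists a1 a2 a3 a4 : 'rV[R]_4 -> R,
    (smooth_on M a1 /\ smooth_on M a2 /\ smooth_on M a3 /\ smooth_on M a4) /\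
    forall x, M x -> forall q1 q2 q3 q4 nu mu,
      dot4 (g x) (C x) (Rm x) q1 q2 q3 q4 nu mu
      - dot4 (g x) (Rm x) (C x) q1 q2 q3 q4 nu mu
      = a1 x * tachibana4 (g x) (C x) q1 q2 q3 q4 nu mu
        + a2 x * tachibana4 (S x) (C x) q1 q2 q3 q4 nu mu
        + a3 x * tachibana4 (g x) (Rm x) q1 q2 q3 q4 nu mu
        + a4 x * tachibana4 (S x) (Rm x) q1 q2 q3 q4 nu mu) /\
  (* (vii) *)
  (forall x, M x ->
    pseudosymmetric2 (g x) (P x) (S x) (- (m * B2 x / B1 x ^+ 2))) /\
  (* (viii), with the sign of the 1-form corrected; the denominator is
     r * B1 * B2 *)
  (forall x, M x -> B2 x != 0 ->
    let r := coord_r x in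
    recurrent_2forms g C
      (row4 0
        (6 * b ^+ 2 * m * (8 * b ^+ 2 * m - 5 * r ^+ 3) /
         (8 * b ^+ 4 * m ^+ 2 * r + 2 * b ^+ 2 * m * r ^+ 4 - r ^+ 7))
        0 0) x) /\
  (* (ix) *)
  (exists s1 s2 s3 : 'rV[R]_4 -> R,
    (smooth_on M s1 /\ smooth_on M s2 /\ smooth_on M s3) /\
    forall x, M x -> forall p q u v,
      Rm x p q u v = s1 x * kulkarni_nomizu (g x) (g x) p q u v
                     + s2 x * kulkarni_nomizu (g x) (S x) p q u v
                     + s3 x * kulkarni_nomizu (S x) (S x) p q u v) /\
  (* (x) *)
  (forall x, M x ->
    let psi1 := 12 * b ^+ 2 * m ^+ 2 * B2 x / B1 x ^+ 3 in
    let psi2 := 288 * b ^+ 4 * m ^+ 4 * B3 x / B1 x ^+ 5 in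
    square2 (g x) (S x) + psi1 *: S x + psi2 *: g x = 0) /\
  (* (xi) *)
  (forall x, M x ->
    let alpha := - (12 * b ^+ 2 * m ^+ 2 / B1 x ^+ 2) in
    \rank (S x - alpha *: g x) = 2%N) /\
  (* (xii) *)
  (forall x, M x ->
    let r := coord_r x in
    let alpha := - (12 * b ^+ 2 * m ^+ 2 / B1 x ^+ 2) in
    let beta := 1 in
    let gamma := 1 in
    let Pi := row4 (- (B x / B1 x)) 1 0 0 in
    let Phi :=
      row4 ((36 * b ^+ 2 * m ^+ 2 * r ^+ 3 + B1 x ^+ 2 * B x)
              / (2 * B1 x ^+ 3))
           (18 * b ^+ 2 * m ^+ 2 * r ^+ 3 / (B1 x ^+ 2 * B x) - 2^-1) 0 0 in
    S x = alpha *: g x + beta *: tensor_product Pi Pi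
          + gamma *: (tensor_product Pi Phi + tensor_product Phi Pi)) /\
  (* (xiii); see swap_pairs for P *)
  (compatible_iff_block m b Rm /\
   compatible_iff_block m b C /\
   compatible_iff_block m b (fun x => swap_pairs (P x)) /\
   compatible_iff_block m b W /\
   compatible_iff_block m b K) /\
  (* (xiv) *)
  (forall x, M x ->
    compatible (g x) (C x) (S x) /\
    compatible (g x) (swap_pairs (P x)) (S x) /\
    compatible (g x) (Rm x) (S x) /\
    compatible (g x) (K x) (S x) /\
    compatible (g x) (W x) (S x)).
Proof.
move=> M g Rm S C P W K B B1 B2 B3.
have uG x (Mx : M x) := hayward_unit Mx.
have RE x (Mx : M x) := riemann_hayward Mx.
have oM : open M by exact: open_hayward_domain.
have c0 : b ^+ 2 * m != 0 by rewrite mulf_neq0 ?expf_neq0.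
split=> [x Mx L|].
  by apply: (pseudosymmetric_family Mx (RE x Mx)); rewrite /L /B2 /B1 coord_rE.
split=> [x Mx L|].
  apply: (pseudosymmetric_family Mx (conformalE (uG x Mx) (hayward_sym m b x) (RE x Mx))).
  have [r0 _ B10] := hayward_domainE Mx.
  by rewrite -hay_weylE // /L /B2 /B1 coord_rE.
split=> [x Mx L|].
  apply: (pseudosymmetric_family Mx (concircularE (uG x Mx) (hayward_sym m b x) (RE x Mx))).
  have [r0 _ B10] := hayward_domainE Mx.
  by rewrite -hay_weylE // /L /B2 /B1 coord_rE.
split=> [x Mx L|].
  apply: (pseudosymmetric_family Mx (conharmonicE (uG x Mx) (hayward_sym m b x) (RE x Mx))).
  have [r0 _] := hayward_domainE Mx.
  rewrite /L /B2 /B1 coord_rE /hay_radial /hay_mixed /hay_sphere /hayB1 /hayB2.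
  by move=> B10; field.
split=> [x Mx B20 L q1 q2 q3 q4 nu mu|].
  by rewrite /L /B2 /B1 coord_rE tachibana_relation // -coord_rE.
split.
  pose pd : {poly R} := m%:P * ((4 * b ^+ 2 * m)%:P - 'X^3).
  pose pB1 : {poly R} := (2 * b ^+ 2 * m)%:P + 'X^3.
  have pB1E r : pB1.[r] = hayB1 m b r by rewrite !horner_evalE.
  (* By (i) and (ii), C.R - R.C = d Q(g, C) - psi Q(g, R) with d = [hay_mixed] and psi = [hay_weyl],
     so the coefficients of Q(S, C) and Q(S, R) are taken to be 0. All are written as ratios of
     polynomials to fit [smooth_on_ratio]. *)
  exists (fun x => pd.[x ord0 ind_r] / (pB1 ^+ 2).[x ord0 ind_r]).
  exists (fun x => (0 : {poly R}).[x ord0 ind_r] / (1 : {poly R}).[x ord0 ind_r]).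
  exists (fun x => (- ('X^3 * pd)).[x ord0 ind_r] / (pB1 ^+ 3).[x ord0 ind_r]).
  exists (fun x => (0 : {poly R}).[x ord0 ind_r] / (1 : {poly R}).[x ord0 ind_r]).
  split.
    split; [|split; [|split]]; apply: smooth_on_ratio => // x Mx; rewrite ?hornerC ?oner_eq0 //.
      by have [_ _ B10] := hayward_domainE Mx; rewrite horner_exp pB1E expf_neq0.
    by have [_ _ B10] := hayward_domainE Mx; rewrite horner_exp pB1E expf_neq0.
  move=> x Mx q1 q2 q3 q4 nu mu; have [r0 _ B10] := hayward_domainE Mx.
  have [_ [_ [RC _]]] := pseudosymmetric_family Mx (RE x Mx) erefl.
  have [CR _] := pseudosymmetric_family Mx
    (conformalE (uG x Mx) (hayward_sym m b x) (RE x Mx)) erefl.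
  rewrite CR RC -hay_weylE // horner0 !horner_exp hornerN hornerM pB1E.
  rewrite /hay_weyl /hay_mixed /pd !horner_evalE /hayB2.
  by move: B10; rewrite /hayB1 => B10; field.
split=> [x Mx|].
  by rewrite /B2 /B1 coord_rE; exact: projective_ricci.
split=> [x Mx B20 r|].
  by rewrite /r coord_rE; apply: recurrent_2forms_hayward; rewrite // -coord_rE.
split.
  pose c := b ^+ 2 * m.
  pose pB1 : {poly R} := (2 * b ^+ 2 * m)%:P + 'X^3.
  have pB1E r : pB1.[r] = hayB1 m b r by rewrite !horner_evalE.
  (* The coefficients of [roter] as ratios of polynomials, which gives their smoothness. *)
  exists (fun x => (m%:P * (- 3%:P * 'X^3 * ('X^6 - (14 * c)%:P * 'X^3 + (4 * c ^+ 2)%:P)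
         + 2%:P * (c%:P - 'X^3) * ('X^3 + (8 * c)%:P) * ('X^3 + (2 * c)%:P)
         - 4%:P * ((4 * c)%:P - 'X^3) * (c%:P - 'X^3) ^+ 2)).[x ord0 ind_r]
       / (3%:P * 'X^3 * pB1 ^+ 3).[x ord0 ind_r]).
  exists (fun x => (pB1 * ('X^3 + (8 * c)%:P)).[x ord0 ind_r]
       / ((36 * c)%:P * 'X^3).[x ord0 ind_r]).
  exists (fun x => (((4 * b ^+ 2 * m)%:P - 'X^3) * pB1 ^+ 3).[x ord0 ind_r]
       / ((432 * c ^+ 2 * m)%:P * 'X^3).[x ord0 ind_r]).
  split.
    split; [|split]; apply: (smooth_on_ratio _ oM) => x Mx;
      have [r0 _ B10] := hayward_domainE Mx;
      by rewrite !(pB1E, hornerXn, horner_exp, hornerM, hornerC) !mulf_neq0 ?expf_neq0.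
  move=> x Mx p q u v; rewrite {1}/Rm roter // -/c -/S -/g.
  by congr (_ * _ + _ * _ + _ * _);
    rewrite /pB1 /hayB1 /hayB2 !horner_evalE.
split=> [x Mx psi1 psi2|].
  by rewrite /psi1 /psi2 /B1 /B2 /B3 coord_rE; exact: square2_ricci_hayward.
split=> [x Mx alpha|].
  by rewrite /alpha /B1 coord_rE; exact: rank_ricci_hayward.
split=> [x Mx r alpha beta gamma Pi Phi|].
  rewrite /alpha /beta /gamma /Pi /Phi /r /B /B1 coord_rE; exact: ricci_chaki.
split; last by move=> x Mx; exact: compatible_ricci.
split; first exact: compatible_iff_block_riemann.
split; first exact: compatible_iff_block_conformal.
split; first exact: compatible_iff_block_projective.
split; first exact: compatible_iff_block_concircular.
exact: compatible_iff_block_conharmonic.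
Qed.
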